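(* Fix a real number $0<p<1$ and an integer $t\ge 0$. Set $b:=1/(1-p)$ and \[ \alpha_{t,p}(n) := 2\log_b n + (t-2)\log_b\log_b n + \log_b\!\left(\frac{t^t}{t!^2}\right) + t\log_b\!\left(\frac{2bp}{e}\right) + 2\log_b\!\left(\frac{e}{2}\right)+1 . \] Then for every $\varepsilon>0$, asymptotically almost surely (as $n\to\infty$) \[ \lfloor \alpha_{t,p}(n)-\varepsilon\rfloor \;\le\; \alpha_t(G_{n,p}) \;\le\; \lfloor \alpha_{t,p}(n)+\varepsilon\rfloor . \]
   Context: For a graph $G=(V,E)$, a vertex subset $S\subseteq V$ is called $t$-stable if the induced subgraph $G[S]$ has maximum degree at most $t$. The $t$-stability number $\alpha_t(G)$ is the maximum order of a $t$-stable set in $G$. $G_{n,p}$ is the random graph on vertex set $V_n=\{1,\dots,n\}$ in which each pair of distinct vertices is an edge with probability $p$, independently of all other pairs. An event holds asymptotically almost surely (a.a.s.) if its probability tends to $1$ as $n\to\infty$. Convention: $0^0=1$. *)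

(* Defs.v *)
From HB Require Import structures.
From mathcomp Require Import all_boot all_order all_algebra.
From mathcomp Require Import all_classical all_reals all_analysis.

Set Implicit Arguments.
Unset Strict Implicit.
Unset Printing Implicit Defensive.

Import Order.TTheory GRing.Theory Num.Theory.
Import numFieldNormedType.Exports.

Local Open Scope ring_scope.

Definition vpairs (T : finType) : {set {set T}} := [set e : {set T} | #|e| == 2%N]%SET.

Record sgraph (T : finType) : Type := SGraph {
  edges : {set {set T}};
  edgesP : edges \subset vpairs T
}.
HB.instance Definition _ (T : finType) := [isSub for @edges T].
HB.instance Definition _ (T : finType) := [Finite of sgraph T by <:].

Definition adj (T : finType) (G : sgraph T) (u v : T) : bool :=
  [set u; v]%SET \in edges G.

(* Degree of v in the subgraph of G induced by S (meant for v in S). *)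
Definition induced_degree (T : finType) (G : sgraph T) (S : {set T}) (v : T) : nat :=
  #|[set u in S | adj G u v]%SET|.

Definition induced_max_degree (T : finType) (G : sgraph T) (S : {set T}) : nat :=
  (\max_(v in S) induced_degree G S v)%N.

Definition stable (t : nat) (T : finType) (G : sgraph T) (S : {set T}) : bool :=
  (induced_max_degree G S <= t)%N.

Definition stability_number (t : nat) (T : finType) (G : sgraph T) : nat :=
  (\max_(S : {set T} | stable t G S) #|S|)%N.

(* The vertex set {1, ..., n} is rendered as 'I_n.  The mass of G is the product
   over all pairs of vertices of the law of the independent edge indicators. *)
Definition Gnp_mass (R : realType) (p : R) (n : nat) (G : sgraph 'I_n) : R :=
  \prod_(e in vpairs 'I_n) (if e \in edges G then p else 1 - p).

Definition Gnp_prob (R : realType) (p : R) (n : nat) (A : pred (sgraph 'I_n)) : R :=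
  \sum_(G : sgraph 'I_n | A G) Gnp_mass p G.

Definition Gnp_aas (R : realType) (p : R) (A : forall n, pred (sgraph 'I_n)) : Prop :=
  (Gnp_prob p (A n) @[n --> \oo] --> (1 : R))%classic.

Definition logb (R : realType) (b x : R) : R := ln x / ln b.

(* t ^ t is a power in nat, so that 0 ^ 0 = 1.  The value for n = 0, 1, where the
   iterated logarithm is not meaningful, is irrelevant asymptotically. *)
Definition alpha_tp (R : realType) (t : nat) (p : R) (n : nat) : R :=
  let b := (1 - p)^-1 in
  let e := expR 1 in
  2 * logb b n%:R
  + (t%:R - 2) * logb b (logb b n%:R)
  + logb b ((t ^ t)%N%:R / (t`! ^ 2)%N%:R)
  + t%:R * logb b (2 * b * p / e)
  + 2 * logb b (e / 2)
  + 1.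

(* Main.v *)
Require Import Defs.
From HB Require Import structures.
From mathcomp Require Import all_boot all_order all_algebra.
From mathcomp Require Import all_classical all_reals all_analysis.
From mathcomp Require Import zify ring lra.
(* Imported last so that the lemmas on finite sets shadow their homonyms on
   classical sets. *)
From mathcomp Require Import fintype finset.

Set Implicit Arguments.
Unset Strict Implicit.
Unset Printing Implicit Defensive.

Import Order.TTheory GRing.Theory Num.Theory.
Import numFieldNormedType.Exports.

(* First and second moment method for the number X_k of t-stable k-sets, with
   q := p / (1 - p) and b := 1 / (1 - p).

   The probability that a k-set is t-stable is b^-C(k,2) W_k, where W_k is the
   sum of q^e(H) over the graphs H of maximum degree at most t on k vertices.
   To estimate W_k, weight H by the product over its vertices v of the falling
   factorial t (t - 1) ... (t - deg v + 1), i.e. count the partial matchings of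
   k t half-edges which induce H.  Adding one edge multiplies the weighted
   number of graphs with m edges by between F (F - t (t + 1)) / (2 (m + 1)) and
   F (F - 1) / (2 (m + 1)), where F = k t - 2 m, whence
     ln W_k = (k t / 2) ln (q k t / e) - k ln t! + O(sqrt k)
   and ln E X_k = (k / 2) ((alpha - k) ln b + o(1)) for k ~ 2 log_b n.

   For the second moment, given that A is t-stable, forgetting the edges inside
   A only helps B to be t-stable.  The resulting conditional probability is at
   most P(B t-stable) b^C(l,2), where l = |A & B|; this is used for l <= k / 2.
   It is also at most the probability that the pairs of B not contained in A
   span at most t |B \ A| edges, which is used for l > k / 2. *)

(** * Counting graphs of bounded degree *)

Local Open Scope nat_scope.

Section Graphs.
Variable T : finType.
Implicit Types (S : {set T}) (E : {set {set T}}) (t : nat).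

Definition pairs S : {set {set T}} := [set e : {set T} | (e \subset S) && (#|e| == 2)].
(** For [E] made of pairs, [u = v] contributes nothing, since [[set v; v]] is a singleton. *)
Definition deg E S v : nat := #|[set u in S | [set u; v] \in E]|.
Definition tstab t E S : bool := [forall v in S, deg E S v <= t].

Lemma card_pairs S : #|pairs S| = 'C(#|S|, 2).
Proof. exact: cards_draws. Qed.

Lemma set2_pairs S u v : ([set u; v] \in pairs S) = [&& u \in S, v \in S & u != v].
Proof. by rewrite inE subUset !sub1set cards2 andbA; case: (u != v). Qed.

Lemma degE E S v : deg E S v = \sum_(u in S) ([set u; v] \in E).
Proof.
rewrite /deg -sum1_card big_mkcond [RHS]big_mkcond /=; apply: eq_bigr => u _.
by rewrite inE; case: (u \in S).
Qed.

Lemma eq_set2 (u v x y : T) : u != v ->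
  ([set u; v] == [set x; y]) = ((u == x) && (v == y)) || ((u == y) && (v == x)).
Proof.
move=> uv; apply/idP/idP; last by case/orP=> /andP[/eqP-> /eqP->] //; rewrite setUC.
move=> /eqP uvE; have := set21 u v; have := set22 u v; move: uv; rewrite uvE !inE.
by move=> uv /orP[]/eqP vE /orP[]/eqP uE; move: uv; rewrite vE uE !eqxx ?orbT.
Qed.

(** Each pair [{x, y}] has exactly the two preimages [(x, y)] and [(y, x)] under the map from
    ordered couples to sets. *)
Lemma pairs_sum S (f : {set T} -> nat) :
  \sum_(u in S) \sum_(v in S | u != v) f [set u; v] = 2 * \sum_(e in pairs S) f e.
Proof.
rewrite pair_big_dep /=.
rewrite (partition_big (fun uv => [set uv.1; uv.2]) (mem (pairs S))) /=; last first.
  by move=> [u v] /= /and3P[uS vS uv]; rewrite set2_pairs uS vS.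
rewrite big_distrr /=; apply: eq_bigr => e.
rewrite inE => /andP[eS /cards2P[x [y [xy eE]]]].
have {eS} [xS yS] : x \in S /\ y \in S.
  by move: eS; rewrite eE subUset !sub1set => /andP[].
rewrite (eq_bigl (mem [set (x, y); (y, x)])); last first.
  move=> [u v] /=; rewrite eE !inE !xpair_eqE.
  case: (eqVneq u v) => [<-|uv] /=.
    by rewrite !andbF /=; apply/esym/negbTE; apply: contra xy => /orP[]/andP[/eqP<- /eqP<-].
  rewrite eq_set2 // andbT; case: (boolP (_ || _)); rewrite ?andbF // andbT.
  by case/orP=> /andP[/eqP-> /eqP->]; rewrite xS yS.
rewrite big_setU1 /= ?big_set1 /=; last by rewrite inE xpair_eqE (negbTE xy).
by rewrite (setUC [set y]) eE; lia.
Qed.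

Lemma handshake E S : E \subset pairs S -> \sum_(v in S) deg E S v = 2 * #|E|.
Proof.
move=> /subsetP ES.
rewrite -sum1_card [in RHS](eq_bigl (fun e => (e \in pairs S) && (e \in E))); last first.
  by move=> e; apply/idP/andP => [eE|[]//]; split=> //; exact: ES.
rewrite big_mkcondr /= -pairs_sum; apply: eq_bigr => v vS.
rewrite degE [RHS]big_mkcondr; apply: eq_bigr => u _.
rewrite setUC; case: eqVneq => [<-|uv] /=; last by case: ifP.
by case: (boolP (_ \in E)) => // /ES; rewrite set2_pairs eqxx !andbF.
Qed.

Lemma deg_add E S e v : e \in pairs S -> e \notin E -> v \in S ->
  deg (e |: E) S v = deg E S v + (v \in e).
Proof.
rewrite inE => /andP[eS /cards2P[x [y [xy eE]]]] enE vS.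
rewrite !degE.
(* If [v] lies in [e], exactly one [u] satisfies [[set u; v] = e], namely the other endpoint;
   otherwise none does. *)
suff -> : nat_of_bool (v \in e) = \sum_(u in S) ([set u; v] == e).
  rewrite -big_split /=; apply: eq_bigr => u _; rewrite in_setU1.
  by case: eqVneq => [->|]; rewrite ?(negbTE enE) ?addn0 ?add0n.
have [xS yS] : x \in S /\ y \in S by move: eS; rewrite eE subUset !sub1set => /andP[].
case: (boolP (v \in e)) => ve.
  have [w [wS wv eE']] : exists w, [/\ w \in S, w != v & e = [set w; v]].
    move: ve; rewrite eE !inE => /orP[]/eqP->; [exists y|exists x].
      by split=> //; [rewrite eq_sym|rewrite setUC].
    by split.
  rewrite (bigD1 w) //= eE' eqxx big1 // => u /andP[uS uw].
  case: eqP => // uvE; have := set21 u v; rewrite uvE !inE (negbTE uw) /= => /eqP uv.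
  by have := set21 w v; rewrite -uvE uv !inE orbb (negbTE wv).
rewrite big1 // => u _; case: eqP => // uve; move: ve; by rewrite -uve !inE eqxx orbT.
Qed.

(* Number of ways to attach the edges of E to half-edges, t of them being
   available at each vertex; it vanishes unless E is t-stable. *)
Definition degw t S E : nat := \prod_(v in S) t ^_ (deg E S v).

Definition num_matchings t S m : nat :=
  \sum_(E : {set {set T}} | (E \subset pairs S) && (#|E| == m)) degw t S E.

Lemma degw_add t S E e : e \in pairs S -> e \notin E ->
  degw t S (e |: E) = degw t S E * \prod_(v in e) (t - deg E S v).
Proof.
move=> eS eE; have /subsetP eS' : e \subset S by move: eS; rewrite inE => /andP[].
rewrite [X in _ * X](eq_bigl (fun v => (v \in S) && (v \in e))); last first.
  by move=> v; apply/idP/andP => [ve|[]//]; split=> //; exact: eS'.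
rewrite big_mkcondr -big_split /=; apply: eq_bigr => v vS.
by rewrite deg_add //; case: (v \in e); rewrite ?addn0 ?muln1 // addn1 ffactnSr.
Qed.

(** Double counting of the graphs with [m.+1] edges and a distinguished edge: removing this edge is
    inverse to adding a new edge to a graph with [m] edges. *)
Lemma num_matchings_succ t S m : m.+1 * num_matchings t S m.+1 =
  \sum_(E : {set {set T}} | (E \subset pairs S) && (#|E| == m))
    \sum_(e in pairs S | e \notin E) degw t S (e |: E).
Proof.
transitivity (\sum_(E : {set {set T}} | (E \subset pairs S) && (#|E| == m.+1))
   \sum_(e in E) degw t S E).
  by rewrite big_distrr; apply: eq_bigr => E /andP[_ /eqP <-]; rewrite sum_nat_const.
rewrite !pair_big_dep /=.
rewrite (reindex_onto (fun Ee : {set {set T}} * {set T} => (Ee.2 |: Ee.1, Ee.2))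
                      (fun Ee => (Ee.1 :\ Ee.2, Ee.2))) /=; last first.
  by move=> [E e] /= /andP[_ eE]; rewrite setD1K.
apply: eq_bigl => -[E e] /=; rewrite xpair_eqE eqxx andbT setU11 andbT.
case: (boolP (e \in E)) => eE /=.
  rewrite !andbF; apply/negbTE; rewrite negb_and; apply/orP; right.
  by apply/negP=> /eqP/setP/(_ e); rewrite setD11 eE.
rewrite setU1K // eqxx andbT subUset sub1set cardsU1 eE add1n eqSS andbT.
by case: (e \in pairs S); rewrite ?andbT ?andbF.
Qed.

Lemma tstab_degw t E S : tstab t E S = (degw t S E != 0).
Proof.
rewrite -lt0n /degw; apply/forall_inP/idP => [H|].
  by apply: prodn_cond_gt0 => v vS; rewrite ffact_gt0 H.
move=> H v vS; move: H; rewrite (bigD1 v) //= muln_gt0 ffact_gt0; by case/andP.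
Qed.

(** Of the [t] half-edges at each vertex, [t - deg E S v] stay free, and every edge consumes two. *)
Lemma sum_slack t E S : E \subset pairs S -> tstab t E S ->
  \sum_(v in S) (t - deg E S v) + 2 * #|E| = #|S| * t.
Proof.
move=> ES /forall_inP st; rewrite -(handshake ES) -big_split -sum_nat_const /=.
by apply: eq_bigr => v vS; rewrite subnK // st.
Qed.

Lemma sum_prod_pairs E S (c : T -> nat) :
  2 * \sum_(e in pairs S | e \notin E) \prod_(v in e) c v =
  \sum_(u in S) c u * \sum_(v in S | (u != v) && ([set u; v] \notin E)) c v.
Proof.
rewrite big_mkcondr /= -pairs_sum; apply: eq_bigr => u uS.
rewrite big_distrr /= [RHS](eq_bigl (fun v => ((v \in S) && (u != v)) && ([set u; v] \notin E))).
  rewrite [RHS]big_mkcondr; apply: eq_bigr => v /andP[vS uv]; case: ifP => // _.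
  by rewrite big_setU1 /= ?big_set1 // inE.
by move=> v; rewrite andbA.
Qed.

(* F counts the free half-edges.  A half-edge is not matched with itself, whence
   the factor F.-1; in the lower bound, a half-edge at u cannot be matched at u
   nor at a neighbour of u, which excludes at most t * t.+1 half-edges. *)
Lemma add_edge_le t S E (F := #|S| * t - 2 * #|E|) : E \subset pairs S -> tstab t E S ->
  2 * \sum_(e in pairs S | e \notin E) \prod_(v in e) (t - deg E S v) <= F * F.-1.
Proof.
move=> ES st; have FE : \sum_(v in S) (t - deg E S v) = F.
  by rewrite /F -(sum_slack ES st) addnK.
rewrite sum_prod_pairs -{1}FE big_distrl /=; apply: leq_sum => u uS.
(* If [u] has a free half-edge, leaving out those of [u] brings the remaining sum to at most
   [F.-1]. *)
case: (posnP (t - deg E S u)) => [->|c0]; first by rewrite !mul0n.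
rewrite leq_mul2l; apply/orP; right; rewrite -FE [X in _ <= X.-1](bigD1 u) //=.
rewrite -subn1 -addnBAC // (leq_trans _ (leq_addl _ _)) //.
rewrite big_mkcond [leqRHS]big_mkcond; apply: leq_sum => v _.
by rewrite eq_sym; case: (v \in S) => //=; case: (v != u) => //=; case: ifP.
Qed.

Lemma add_edge_ge t S E (F := #|S| * t - 2 * #|E|) : E \subset pairs S -> tstab t E S ->
  F * (F - t * t.+1) <=
  2 * \sum_(e in pairs S | e \notin E) \prod_(v in e) (t - deg E S v).
Proof.
move=> ES st; have FE : \sum_(v in S) (t - deg E S v) = F.
  by rewrite /F -(sum_slack ES st) addnK.
rewrite sum_prod_pairs -{1}FE big_distrl /=; apply: leq_sum => u uS.
rewrite leq_mul2l; apply/orP; right; rewrite leq_subLR -FE.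
rewrite (bigID (fun v => (u != v) && ([set u; v] \notin E))) /= addnC leq_add2r.
apply: (@leq_trans (\sum_(v in u |: [set v in S | [set v; u] \in E]) t)).
  rewrite big_mkcond [leqRHS]big_mkcond; apply: leq_sum => v _.
  rewrite !inE negb_and !negbK (eq_sym v) (setUC [set v]); case: (v \in S) => //=.
  by case: ifP => // _; exact: leq_subr.
rewrite sum_nat_const mulnC leq_mul2l; apply/orP; right.
apply: leq_trans (leq_of_leqif (leq_card_setU _ _)) _; rewrite cards1 add1n ltnS.
by move/forall_inP: st; apply.
Qed.

Lemma num_matchings0 t S : num_matchings t S 0 = 1.
Proof.
rewrite /num_matchings (big_pred1 set0) => [|E]; last first.
  rewrite cards_eq0 /=; case: eqVneq => [->|]; rewrite ?sub0set ?andbF //.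
rewrite /degw big1 // => v _; rewrite /deg (_ : [set _ in _ | _] = set0) ?cards0 //.
by apply/setP => u; rewrite !inE andbF.
Qed.

Lemma num_matchings_upper_step t S m (F := #|S| * t - 2 * m) :
  2 * m.+1 * num_matchings t S m.+1 <= F * F.-1 * num_matchings t S m.
Proof.
rewrite -mulnA num_matchings_succ big_distrr [leqRHS]big_distrr /=.
apply: leq_sum => E /andP[ES /eqP Em].
rewrite (eq_bigr (fun e : {set T} => degw t S E * \prod_(v in e) (t - deg E S v))); last first.
  by move=> e /andP[eS eE]; rewrite degw_add.
rewrite -big_distrr /= mulnCA [leqRHS]mulnC.
case: (posnP (degw t S E)) => [->|]; rewrite ?mul0n // lt0n -tstab_degw => st.
by rewrite leq_mul2l /F -Em add_edge_le ?orbT.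
Qed.

Lemma num_matchings_lower_step t S m (F := #|S| * t - 2 * m) :
  F * (F - t * t.+1) * num_matchings t S m <= 2 * m.+1 * num_matchings t S m.+1.
Proof.
rewrite -[leqRHS]mulnA num_matchings_succ big_distrr [leqRHS]big_distrr /=.
apply: leq_sum => E /andP[ES /eqP Em].
rewrite (eq_bigr (fun e : {set T} => degw t S E * \prod_(v in e) (t - deg E S v))); last first.
  by move=> e /andP[eS eE]; rewrite degw_add.
rewrite -big_distrr /= [leqLHS]mulnC [leqRHS]mulnCA.
case: (posnP (degw t S E)) => [->|]; rewrite ?mul0n // lt0n -tstab_degw => st.
by rewrite leq_mul2l /F -Em add_edge_ge ?orbT.
Qed.

(** The factors [F * F.-1] of the successive steps, for [F = #|S| * t, #|S| * t - 2, ...], multiply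
    to a quotient of factorials, here cleared of its denominator. *)
Lemma num_matchings_upper t S m : 2 * m <= #|S| * t ->
  num_matchings t S m * m`! * 2 ^ m * (#|S| * t - 2 * m)`! <= (#|S| * t)`!.
Proof.
elim: m => [|m IH] mM; first by rewrite num_matchings0 !mul1n muln0 subn0.
apply: leq_trans (IH _); last by lia.
have := num_matchings_upper_step t S m; set F := _ - _ => /= step.
have FE : F = (#|S| * t - 2 * m.+1).+2 by rewrite /F; lia.
have -> : F`! = F * F.-1 * (#|S| * t - 2 * m.+1)`! by rewrite FE !factS mulnA.
rewrite factS expnS.
move: step; set A := num_matchings _ _ _; set B := num_matchings _ _ _; set D := (_ - _)`!.
move=> step; have := leq_mul step (leqnn (m`! * 2 ^ m * D)); congr (_ <= _); lia.
Qed.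

(** Same telescoping with [L] in place of [#|S| * t]: the step factor [F * (F - t * t.+1)] dominates
    [(L - 2 * m) * (L - 2 * m).-1]. *)
Lemma num_matchings_lower t S m (L := #|S| * t - t * t.+1) : 2 * m <= L ->
  L`! <= num_matchings t S m * m`! * 2 ^ m * (L - 2 * m)`!.
Proof.
elim: m => [|m IH] mL; first by rewrite num_matchings0 !mul1n muln0 subn0.
apply: leq_trans (IH _) _; first by lia.
have := num_matchings_lower_step t S m; set F := _ - 2 * m => /= step.
have FE : L - 2 * m = (L - 2 * m.+1).+2 by lia.
have -> : (L - 2 * m)`! = (L - 2 * m) * (L - 2 * m).-1 * (L - 2 * m.+1)`!.
  by rewrite FE !factS mulnA.
rewrite factS expnS.
have step2 : (L - 2 * m) * (L - 2 * m).-1 <= F * (F - t * t.+1).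
  by apply: leq_mul; rewrite /F /L; lia.
move: step step2; set A := num_matchings _ _ _; set B := num_matchings _ _ _; set D := (_ - _)`!.
set X := _ * _.-1; set Y := F * _ => step step2.
have := leq_mul step2 (leqnn (A * m`! * 2 ^ m * D)).
have := leq_mul step (leqnn (m`! * 2 ^ m * D)); nia.
Qed.

Lemma degw_le t S E : degw t S E <= t`! ^ #|S|.
Proof.
rewrite -prod_nat_const; apply: leq_prod => v _.
case: (leqP (deg E S v) t) => dt; last by rewrite ffact_small.
by rewrite -(ffact_fact dt) leq_pmulr // fact_gt0.
Qed.

(** At a vertex of degree [d], [t! = t ^_ d * (t - d)!] and [(t - d)! <= t! ^ (t - d)]. So replacing
    the weight by its maximum costs at most one factor [t!] per free half-edge. *)
Lemma degw_ge t S E : E \subset pairs S -> tstab t E S ->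
  t`! ^ #|S| <= degw t S E * t`! ^ (#|S| * t - 2 * #|E|).
Proof.
move=> ES st; have FE : \sum_(v in S) (t - deg E S v) = #|S| * t - 2 * #|E|.
  by rewrite -(sum_slack ES st) addnK.
rewrite -FE expn_sum -big_split /= -prod_nat_const; apply: leq_prod => v vS.
have dt : deg E S v <= t by move/forall_inP: st; apply.
rewrite -{1}(ffact_fact dt) leq_mul2l; apply/orP; right.
case: (posnP (t - deg E S v)) => [->|r0] //.
apply: (@leq_trans (t`! ^ 1)); last by rewrite leq_pexp2l ?fact_gt0.
by rewrite expn1 leq_fact // leq_subr.
Qed.
End Graphs.

(** * Independent edges *)

Local Open Scope ring_scope.

Section ProductMeasure.
Variables (R : realFieldType) (U : finType).
Implicit Types (P Q E : {set U}) (F G : {set U} -> R).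

Lemma sum_subsets_prod (a c : R) P :
  \sum_(E : {set U} | E \subset P) \prod_(e in P) (if e \in E then a else c)
  = (a + c) ^+ #|P|.
Proof.
rewrite -prodr_const [RHS]big_mkcond.
(* Outside [P] the two alternatives weigh 0 and 1, so that only the subsets of [P] survive the
   expansion over all subsets of [U]. *)
transitivity (\prod_(e : U) ((if e \in P then a else 0) + (if e \in P then c else 1))).
  rewrite bigA_distr big_mkcond; apply: eq_bigr => E _.
  case: ifP => [/subsetP EP|/negbT/subsetPn[e eE eP]].
    rewrite big_mkcond; apply: eq_bigr => e _.
    by case: (boolP (e \in E)) => [/EP ->|_].
  by rewrite (bigD1 e) //= eE (negbTE eP) mul0r.
by apply: eq_bigr => e _; case: ifP; rewrite ?add0r.
Qed.

Lemma prod_if_mem (a c : R) P E : E \subset P ->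
  \prod_(e in P) (if e \in E then a else c) = a ^+ #|E| * c ^+ #|P :\: E|.
Proof.
move=> EP; rewrite (big_setID E) /= (setIidPr EP) -!prodr_const; congr (_ * _).
  by apply: eq_bigr => e ->.
by apply: eq_bigr => e; rewrite inE => /andP[/negbTE ->].
Qed.

Variable p : R.
(** Probability of drawing exactly [E] when the elements of [P] are kept independently with
    probability [p]; [Ex P F] is the corresponding expectation, and probabilities are expectations
    of indicators. *)
Definition pmass P E : R := \prod_(e in P) (if e \in E then p else 1 - p).
Definition Ex P F : R := \sum_(E : {set U} | E \subset P) pmass P E * F E.

Lemma pmassU Q P E1 E2 : Q \subset P -> E1 \subset Q -> E2 \subset P :\: Q ->
  pmass P (E1 :|: E2) = pmass Q E1 * pmass (P :\: Q) E2.
Proof.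
move=> QP /subsetP E1Q /subsetP E2Q.
rewrite /pmass (big_setID Q) /= (setIidPr QP); congr (_ * _); apply: eq_bigr => e eQ.
  rewrite inE; case: (boolP (e \in E2)) => [/E2Q|]; last by rewrite orbF.
  by rewrite inE eQ.
rewrite inE; case: (boolP (e \in E1)) => [/E1Q e1|//].
by move: eQ; rewrite inE e1.
Qed.

(** Fubini: the draws in [Q] and in [P :\: Q] are independent, and [E] splits uniquely into
    [E :&: Q] and [E :\: Q]. *)
Lemma Ex_setD Q P F : Q \subset P ->
  Ex P F = Ex Q (fun E1 => Ex (P :\: Q) (fun E2 => F (E1 :|: E2))).
Proof.
move=> QP; rewrite /Ex.
under [RHS]eq_bigr => E1 _ do rewrite big_distrr /=.
rewrite pair_big_dep /=.
rewrite (reindex_onto (fun x : {set U} * {set U} => x.1 :|: x.2)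
                      (fun E => (E :&: Q, E :\: Q))) /=; last by move=> E _; rewrite setID.
have sub (E1 E2 : {set U}) :
   (E1 :|: E2 \subset P) && (((E1 :|: E2) :&: Q, (E1 :|: E2) :\: Q) == (E1, E2))
   = (E1 \subset Q) && (E2 \subset P :\: Q).
  rewrite xpair_eqE; apply/idP/idP.
    case/and3P; rewrite subUset => /andP[_ E2P] /eqP <- /eqP E2E.
    rewrite subsetIr /= subsetD E2P -E2E disjoint_sym disjoints_subset.
    by rewrite setDE setCI setCK subsetUr.
  case/andP=> E1Q; rewrite subsetD => /andP[E2P dE].
  rewrite subUset E2P (subset_trans E1Q QP) /= setIUl setDUl.
  rewrite (setIidPl E1Q) (disjoint_setI0 dE) setU0 eqxx /=.
  by rewrite (eqP (_ : E1 :\: Q == set0)) ?setD_eq0 // set0U; apply/eqP/setDidPl.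
rewrite (eq_bigl (fun x : {set U} * {set U} => (x.1 \subset Q) && (x.2 \subset P :\: Q))) => [|x].
  by apply: eq_bigr => -[E1 E2] /= /andP[? ?]; rewrite (pmassU QP) // mulrA.
by rewrite -sub -surjective_pairing.
Qed.

Lemma Ex_cst P (c : R) : Ex P (fun=> c) = c.
Proof. by rewrite /Ex -big_distrl /= sum_subsets_prod addrC subrK expr1n mul1r. Qed.

Lemma eq_Ex P F G : (forall E, E \subset P -> F E = G E) -> Ex P F = Ex P G.
Proof. by move=> FG; apply: eq_bigr => E /FG ->. Qed.

Lemma Ex_marginal Q P F : Q \subset P ->
  (forall E, E \subset P -> F E = F (E :&: Q)) -> Ex P F = Ex Q F.
Proof.
move=> QP FQ; rewrite (Ex_setD _ QP); apply: eq_Ex => E1 E1Q.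
rewrite -[RHS](Ex_cst (P :\: Q)); apply: eq_Ex => E2.
rewrite subsetD => /andP[E2P dE]; rewrite FQ ?subUset ?(subset_trans E1Q QP) //.
by rewrite setIUl (setIidPl E1Q) (disjoint_setI0 dE) setU0.
Qed.

Lemma Ex_mull P (c : R) F : Ex P (fun E => c * F E) = c * Ex P F.
Proof. by rewrite /Ex big_distrr; apply: eq_bigr => E _; rewrite mulrCA. Qed.

Lemma Ex_add P F G : Ex P (fun E => F E + G E) = Ex P F + Ex P G.
Proof. by rewrite /Ex -big_split; apply: eq_bigr => E _; rewrite mulrDr. Qed.

Lemma Ex_sum P (I : finType) (D : pred I) (F : I -> {set U} -> R) :
  Ex P (fun E => \sum_(i | D i) F i E) = \sum_(i | D i) Ex P (F i).
Proof. by rewrite /Ex exchange_big; apply: eq_bigr => E _; rewrite big_distrr. Qed.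

Hypothesis p01 : 0 < p < 1.

Lemma pmass_gt0 P E : 0 < pmass P E.
Proof.
by case/andP: p01 => p0 p1; apply: prodr_gt0 => e _; case: ifP; rewrite ?subr_gt0.
Qed.

Lemma le_Ex P F G : (forall E, E \subset P -> F E <= G E) -> Ex P F <= Ex P G.
Proof.
by move=> FG; apply: ler_sum => E /FG; rewrite ler_pM2l ?pmass_gt0.
Qed.

(** Only the outcome [set0] is kept in the sum. *)
Lemma Ex_ge_empty P F : (forall E, 0 <= F E) -> (1 - p) ^+ #|P| * F set0 <= Ex P F.
Proof.
move=> F0; rewrite /Ex (bigD1 set0) ?sub0set //=.
have -> : pmass P set0 = (1 - p) ^+ #|P|.
  by rewrite /pmass -prodr_const; apply: eq_bigr => e _; rewrite inE.
by rewrite lerDl sumr_ge0 // => E _; rewrite mulr_ge0 // ltW // pmass_gt0.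
Qed.

Lemma Ex_pow_card P (y : R) : Ex P (fun E => y ^+ #|E|) = (p * y + (1 - p)) ^+ #|P|.
Proof.
rewrite -sum_subsets_prod; apply: eq_bigr => E EP.
by rewrite /pmass !prod_if_mem // exprMn mulrAC.
Qed.

(* Chernoff's bound: 1[#|E| <= m] <= y ^ (#|E| - m) for y <= 1. *)
Lemma Ex_card_le P (y : R) m : 0 < y -> y <= 1 ->
  Ex P (fun E => (#|E| <= m)%:R) <= y ^- m * (p * y + (1 - p)) ^+ #|P|.
Proof.
move=> y0 y1; rewrite -Ex_pow_card -Ex_mull; apply: le_Ex => E _.
case: (leqP #|E| m) => [Em|_] /=; last by rewrite mulr_ge0 ?invr_ge0 ?exprn_ge0 ?ltW.
by rewrite mulrC ler_pdivlMr ?exprn_gt0 // mul1r ler_wiXn2l // ltW.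
Qed.
End ProductMeasure.

(** * Second moment of the number of stable sets *)

Local Open Scope nat_scope.

Section StableSets.
Variable T : finType.
Implicit Types (S A B : {set T}) (E : {set {set T}}) (t : nat).

Lemma pairsS A B : A \subset B -> pairs A \subset pairs B.
Proof.
by move=> AB; apply/subsetP => e; rewrite !inE => /andP[eA ->]; rewrite (subset_trans eA).
Qed.

Lemma pairsI A B : pairs (A :&: B) = pairs A :&: pairs B.
Proof. by apply/setP => e; rewrite !inE subsetI; case: (#|e| == 2); rewrite ?andbT ?andbF. Qed.

Lemma leq_deg E E' S S' v : E \subset E' -> S \subset S' -> deg E S v <= deg E' S' v.
Proof.
move=> /subsetP EE /subsetP SS; apply/subset_leq_card/subsetP => u; rewrite !inE.
by case/andP=> /SS -> /EE ->.
Qed.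

Lemma tstab_sub t E E' S S' : E \subset E' -> S \subset S' -> tstab t E' S' -> tstab t E S.
Proof.
move=> EE SS /forall_inP st; apply/forall_inP => v vS.
by apply: leq_trans (st v (subsetP SS _ vS)); exact: leq_deg.
Qed.

Lemma tstab_pairs t E S : E \subset pairs setT -> tstab t (E :&: pairs S) S = tstab t E S.
Proof.
move=> /subsetP ET; apply: eq_forallb_in => v vS; congr (_ <= _).
apply: eq_card => u; rewrite !inE; case: (boolP (u \in S)) => //= uS.
case: (boolP (_ \in E)) => //= /ET; rewrite set2_pairs => /and3P[_ _ uv].
by rewrite subUset !sub1set uS vS cards2 uv.
Qed.

(** An edge that is not inside [A] has an endpoint in [B :\: A], and each such vertex carries at
    most [t] edges. *)
Lemma card_tstab_outside t E A B : E \subset pairs B :\: pairs A -> tstab t E B ->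
  #|E| <= t * #|B :\: A|.
Proof.
move=> /subsetP EQ /forall_inP st.
apply: (@leq_trans #|\bigcup_(v in B :\: A)
    [set [set u; v] | u in [set u in B | [set u; v] \in E]]|).
  apply/subset_leq_card/subsetP => e eE; have := EQ e eE.
  rewrite !inE => /andP[]; rewrite negb_and => eA /andP[eB e2]; rewrite e2 orbF in eA.
  have [v ve vA] := subsetPn eA.
  have [u [uB uv eE']] : exists u, [/\ u \in B, u != v & e = [set u; v]].
    have /cards2P[x [y [xy exy]]] := e2.
    move: eB; rewrite exy subUset !sub1set => /andP[xB yB].
    move: ve; rewrite exy !inE => /orP[]/eqP ->; [exists y|exists x]; split=> //.
      by rewrite eq_sym.
    by rewrite setUC.
  apply/bigcupP; exists v; first by rewrite inE vA (subsetP eB).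
  by apply/imsetP; exists u; rewrite // inE uB -eE'.
apply: (@leq_trans (\sum_(v in B :\: A)
    #|[set [set u; v] | u in [set u in B | [set u; v] \in E]]|)).
  elim/big_rec2: _ => [|v m X _ IH]; first by rewrite cards0.
  by apply: leq_trans (leq_of_leqif (leq_card_setU _ _)) _; rewrite leq_add2l.
rewrite mulnC -sum_nat_const; apply: leq_sum => v; rewrite inE => /andP[_ vB].
by apply: leq_trans (leq_imset_card _ _) _; exact: st.
Qed.

(** [B] is determined by [A :&: B] and [B :\: A], of sizes [l] and [k - l]. *)
Lemma card_meet A k l : #|A| = k ->
  #|[set B : {set T} | (#|B| == k) && (#|A :&: B| == l)]| <= 'C(k, l) * 'C(#|T| - k, k - l).
Proof.
move=> Ak; set D := [set B | _].
have inj : {in D &, injective (fun B => (A :&: B, B :\: A))}.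
  by move=> B B' _ _ [e1 e2]; rewrite -(setID B A) -(setID B' A) e2 ![_ :&: A]setIC e1.
rewrite -(card_in_imset inj).
have -> : 'C(k, l) * 'C(#|T| - k, k - l) =
  #|setX [set X : {set T} | (X \subset A) && (#|X| == l)]
         [set X : {set T} | (X \subset ~: A) && (#|X| == k - l)]|.
  by rewrite cardsX !cards_draws Ak cardsCs setCK Ak.
apply/subset_leq_card/subsetP => x /imsetP[B]; rewrite inE => /andP[/eqP Bk /eqP ABl] ->.
rewrite !inE subsetIl ABl eqxx /= setDE subsetIr /=.
by rewrite -setDE cardsD setIC ABl Bk.
Qed.
End StableSets.

(** * Estimates on binomial coefficients *)

Lemma leq_bin_exp n m : 'C(n, m) <= n ^ m.
Proof.
apply: (@leq_trans (n ^_ m)); first by rewrite -bin_ffact leq_pmulr // fact_gt0.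
by elim: m => [|m IH] //; rewrite ffactnSr expnSr leq_mul // leq_subr.
Qed.

(** Factor by factor, [(k - i) * n <= (n - i) * k] when [k <= n]. *)
Lemma ffact_ratio n k m : k <= n -> k ^_ m * n ^ m <= n ^_ m * k ^ m.
Proof.
move=> kn; elim: m => [|m IH] //; rewrite !ffactnSr !expnSr.
have h : (k - m) * n <= (n - m) * k by nia.
by rewrite mulnACA [leqRHS]mulnACA; exact: leq_mul.
Qed.

Lemma bin_ratio n k m : k <= n -> 'C(k, m) * n ^ m <= 'C(n, m) * k ^ m.
Proof.
move=> kn; rewrite -(leq_pmul2r (fact_gt0 m)) mulnAC bin_ffact [leqRHS]mulnAC bin_ffact.
exact: ffact_ratio.
Qed.

(** Both sides count the [l]-sets contained in a chosen [k]-set, inside a set of size [n]. *)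
Lemma bin_nested n k l : l <= k -> k <= n ->
  'C(n, l) * 'C(n - l, k - l) = 'C(n, k) * 'C(k, l).
Proof.
move=> lk kn; have ln := leq_trans lk kn.
apply/eqP; rewrite -(eqn_pmul2r (fact_gt0 l)) -(eqn_pmul2r (fact_gt0 (k - l))).
rewrite -(eqn_pmul2r (fact_gt0 (n - k))); apply/eqP.
transitivity n`!.
  have e : n - l - (k - l) = n - k by lia.
  rewrite -(bin_fact ln) -(@bin_fact (n - l) (k - l)) ?leq_sub2r // e; lia.
rewrite -(bin_fact kn) -(bin_fact lk); lia.
Qed.

(** By [bin_nested], the quotient of ['C(k, l) * 'C(n - l, k - l)] by ['C(n, k)] is
    ['C(k, l)^2 / 'C(n, l)]. One factor ['C(k, l)] is at most [k^l]; the other, over ['C(n, l)], is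
    at most [(k / n)^l]. So a proportion at most [(k^2 / n)^l] of the [k]-sets meets [A] in [l]
    points. *)
Lemma card_meet_le (T : finType) (A : {set T}) k l : #|A| = k -> l <= k ->
  #|[set B : {set T} | (#|B| == k) && (#|A :&: B| == l)]| * #|T| ^ l
    <= k ^ l * k ^ l * 'C(#|T|, k).
Proof.
move=> Ak lk; have kn : k <= #|T| by rewrite -Ak max_card.
have ln := leq_trans lk kn.
have h : 0 < 'C(#|T|, l) by rewrite bin_gt0.
rewrite -(leq_pmul2r h); have := card_meet l Ak; set N := #|_|.
have : 'C(#|T| - k, k - l) <= 'C(#|T| - l, k - l) by apply: leq_bin2l; lia.
have := bin_nested lk kn; have := bin_ratio l kn; have := leq_bin_exp k l.
move: 'C(k, l) 'C(#|T|, l) 'C(#|T|, k) 'C(#|T| - k, k - l) 'C(#|T| - l, k - l) (#|T| ^ l) (k ^ l).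
move=> c d f g g' nl kl c_le ratio nest gg NN.
apply: (@leq_trans (c * g' * nl * d)).
  rewrite !leq_mul2r; apply/orP; right; apply/orP; right.
  by rewrite (leq_trans NN) // leq_mul2l gg orbT.
have -> : c * g' * nl * d = (d * g') * (c * nl) by lia.
rewrite nest; have -> : kl * kl * f * d = f * kl * (d * kl) by lia.
by apply: leq_mul => //; rewrite leq_mul2l c_le orbT.
Qed.

Local Open Scope ring_scope.

(** * Probability that a set is stable; first and second moments *)

Lemma Ex_imset (R : realFieldType) (U V : finType) (p : R) (g : V -> U)
    (P : {set V}) (F : {set U} -> R) : injective g ->
  Ex p (g @: P) F = Ex p P (fun E => F (g @: E)).
Proof.
move=> gI; have preK (E : {set V}) : g @^-1: (g @: E) = E.
  by apply/setP => e; rewrite inE mem_imset.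
have imK (E : {set U}) : E \subset g @: P -> g @: (g @^-1: E) = E.
  move=> /subsetP EP; apply/setP => e; apply/imsetP/idP => [[e' ] | eE].
    by rewrite inE => ? ->.
  by have /imsetP[e' e'P ee'] := EP e eE; exists e'; rewrite // inE -ee'.
rewrite /Ex (reindex_onto (fun E : {set V} => g @: E) (fun E => g @^-1: E)) => [|E /imK//].
rewrite (eq_bigl (fun E : {set V} => E \subset P)) => [|E]; last first.
  rewrite preK eqxx andbT; apply/idP/idP => [|EP]; last exact: imsetS.
  by move=> /(preimsetS g); rewrite !preK.
apply: eq_bigr => E _; congr (_ * _); rewrite /pmass big_imset /=; last by move=> ? ? _ _ /gI.
by apply: eq_bigr => e _; rewrite mem_imset.
Qed.

Section StableProbability.
Variables (R : realFieldType) (p : R) (t : nat).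

Definition stab_prob (T : finType) (S : {set T}) : R :=
  Ex p (pairs S) (fun E => (tstab t E S)%:R).

(** The law of the edges is invariant under relabelling. Applied to an enumeration of [S], this
    shows in [stab_probE] that only the size of [S] matters. *)
Lemma stab_prob_imset (T T' : finType) (f : T' -> T) (S : {set T'}) : injective f ->
  stab_prob (f @: S) = stab_prob S.
Proof.
move=> fI; have gI : injective (fun e : {set T'} => f @: e) by exact: imset_inj.
have pE : pairs (f @: S) = [set f @: e | e : {set T'} in pairs S].
  apply/setP => e; apply/idP/imsetP.
    rewrite inE => /andP[/subsetP eS /eqP e2].
    have eE : e = f @: (f @^-1: e).
      apply/setP => x; apply/idP/imsetP => [xe|[y]]; last by rewrite inE => ? ->.
      by have /imsetP[y _ xy] := eS x xe; exists y; rewrite // inE -xy.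
    exists (f @^-1: e); last by [].
    rewrite inE -(card_imset _ fI) -eE e2 eqxx andbT.
    by apply/subsetP => x; rewrite inE => /eS; rewrite mem_imset.
  move=> [e']; rewrite inE => /andP[eS /eqP e2] ->.
  by rewrite inE imsetS // card_imset // e2.
rewrite /stab_prob pE Ex_imset //; apply: eq_Ex => E _; congr (_%:R); congr (nat_of_bool _).
have degI v : deg [set f @: e | e : {set T'} in E] (f @: S) (f v) = deg E S v.
  rewrite !degE big_imset /=; last by move=> ? ? _ _ /fI.
  apply: eq_bigr => u _; congr (nat_of_bool _).
  by rewrite -(mem_imset _ _ gI) imsetU !imset_set1.
apply/forall_inP/forall_inP => H v; first by move=> vS; rewrite -degI H // mem_imset.
by move=> /imsetP[x xS ->]; rewrite degI H.
Qed.

Definition stab_probn (k : nat) : R := stab_prob [set: 'I_k].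

Lemma stab_probE (T : finType) (S : {set T}) : stab_prob S = stab_probn #|S|.
Proof.
rewrite /stab_probn -(stab_prob_imset _ (@enum_val_inj _ (mem S))).
congr stab_prob; apply/setP => x; apply/idP/imsetP => [xS|[i _ ->]]; last exact: enum_valP.
by exists (enum_rank_in xS x); rewrite ?inE // enum_rankK_in.
Qed.

Hypothesis p01 : 0 < p < 1.

Variable T : finType.
Implicit Types (S A B : {set T}).
Let G : {set {set T}} := pairs [set: T].

Lemma stab_prob_global S : Ex p G (fun E => (tstab t E S)%:R) = stab_probn #|S|.
Proof.
rewrite -stab_probE; apply: Ex_marginal; first exact/pairsS/subsetT.
by move=> E EG; rewrite tstab_pairs.
Qed.

(* Probability that B is t-stable once the edges inside A are removed. *)
Definition ext_prob A B : R := Ex p (pairs B :\: pairs A) (fun E => (tstab t E B)%:R).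

(* Given the edges inside A, removing them can only help B to be t-stable. *)
Lemma joint_stab_prob A B :
  Ex p G (fun E => (tstab t E A)%:R * (tstab t E B)%:R) <= stab_probn #|A| * ext_prob A B.
Proof.
have AG : pairs A \subset G by apply/pairsS/subsetT.
have -> : ext_prob A B = Ex p (G :\: pairs A) (fun E => (tstab t E B)%:R).
  symmetry; apply: Ex_marginal; first exact/setSD/pairsS/subsetT.
  move=> E; rewrite subsetD => /andP[EG dE]; congr (_%:R); congr (nat_of_bool _).
  rewrite -tstab_pairs //; congr tstab; rewrite setIDA.
  by apply/esym/setDidPl; rewrite (disjointWl _ dE) // subsetIl.
rewrite (Ex_setD _ _ AG) mulrC -stab_probE -Ex_mull; apply: le_Ex => // E1 E1A.
rewrite mulrC -Ex_mull; apply: le_Ex => // E2 E2A.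
have a : tstab t (E1 :|: E2) A -> tstab t E1 A by apply: tstab_sub; rewrite ?subsetUl.
have b : tstab t (E1 :|: E2) B -> tstab t E2 B by apply: tstab_sub; rewrite ?subsetUr.
rewrite -!natrM ler_nat !mulnb; case: (tstab t (E1 :|: E2) A) a => // ->; rewrite ?andbT //=.
by case: (tstab t (E1 :|: E2) B) b => // ->.
Qed.

(** The edges inside [A :&: B] are all absent with probability [(1 - p) ^+ 'C(#|A :&: B|, 2)],
    independently of the other edges inside [B]; when they are absent, the stability of [B] depends
    on the others alone. *)
Lemma ext_prob_le_indep A B :
  ext_prob A B * (1 - p) ^+ 'C(#|A :&: B|, 2) <= stab_probn #|B|.
Proof.
rewrite -stab_probE /stab_prob (Ex_setD _ _ (subsetDl (pairs B) (pairs A))) mulrC.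
rewrite -Ex_mull; apply: le_Ex => // E EQ.
rewrite -card_pairs pairsI setIC setDDr setDv set0U.
by apply: (le_trans _ (Ex_ge_empty p01 _ _)) => //; rewrite setU0.
Qed.

(** If [B] is stable, at most [t * #|B :\: A|] of its pairs not inside [A] are edges, by
    [card_tstab_outside]; Chernoff's bound then applies. *)
Lemma ext_prob_le_card A B (y : R) : 0 < y -> y <= 1 ->
  ext_prob A B <= y ^- (t * #|B :\: A|) * (p * y + (1 - p)) ^+ ('C(#|B|, 2) - 'C(#|A :&: B|, 2)).
Proof.
move=> y0 y1.
have -> : ('C(#|B|, 2) - 'C(#|A :&: B|, 2))%N = #|pairs B :\: pairs A|.
  by rewrite -!card_pairs cardsD pairsI setIC.
apply: le_trans (Ex_card_le p01 _ _ y0 y1); apply: le_Ex => // E EQ.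
by rewrite ler_nat; case: (boolP (tstab t E B)) => // /(card_tstab_outside EQ) ->.
Qed.

Definition nstab k (E : {set {set T}}) : R := \sum_(S : {set T} | #|S| == k) (tstab t E S)%:R.
Definition nostab k (E : {set {set T}}) : bool :=
  [forall S : {set T}, (#|S| == k) ==> ~~ tstab t E S].

Definition mean_stab k : R := 'C(#|T|, k)%:R * stab_probn k.

Lemma Ex_nstab k : Ex p G (nstab k) = mean_stab k.
Proof.
rewrite /nstab Ex_sum (eq_bigr (fun=> stab_probn k)) => [|S /eqP <-]; last first.
  exact: stab_prob_global.
rewrite sumr_const /mean_stab mulr_natl; congr (_ *+ _).
by rewrite -(card_draws T k) -sum1_card -[in RHS]sum1_card; apply: eq_bigl => S; rewrite !inE.
Qed.

(** Markov's inequality: the count [nstab k E] is at least 1 unless [nostab k E] holds. *)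
Lemma first_moment k : Ex p G (fun E => (~~ nostab k E)%:R) <= mean_stab k.
Proof.
rewrite -Ex_nstab; apply: le_Ex => // E _.
have nn (S : {set T}) : 0 <= (tstab t E S)%:R :> R by [].
case: (boolP (nostab k E)) => [_|]; first exact: sumr_ge0.
case/forallPn => S; rewrite negb_imply negbK => /andP[Sk st].
by rewrite /nstab (bigD1 S) //= st lerDl sumr_ge0.
Qed.

(** On the event [nostab] the square of [nstab k E - mu] equals [mu ^+ 2], and its expectation is
    the variance on the right. *)
Lemma chebyshev k : mean_stab k ^+ 2 * Ex p G (fun E => (nostab k E)%:R)
  <= Ex p G (fun E => nstab k E ^+ 2) - mean_stab k ^+ 2.
Proof.
set mu := mean_stab k.
apply: (@le_trans _ _ (Ex p G (fun E => nstab k E ^+ 2 + ((- 2 * mu) * nstab k E + mu ^+ 2)))).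
  rewrite -Ex_mull; apply: le_Ex => // E _.
  have -> : nstab k E ^+ 2 + (- 2 * mu * nstab k E + mu ^+ 2) = (nstab k E - mu) ^+ 2 by ring.
  case: (boolP (nostab k E)) => [no|_]; last by rewrite mulr0 sqr_ge0.
  rewrite /nstab big1 => [|S Sk]; first by rewrite sub0r sqrrN mulr1.
  by have /forallP/(_ S) := no; rewrite Sk /= => /negbTE ->.
by rewrite !Ex_add Ex_mull Ex_cst Ex_nstab -/mu; lra.
Qed.

Lemma second_moment k : Ex p G (fun E => nstab k E ^+ 2) <=
  stab_probn k * \sum_(A : {set T} | #|A| == k) \sum_(B : {set T} | #|B| == k) ext_prob A B.
Proof.
have -> : Ex p G (fun E => nstab k E ^+ 2) = \sum_(A : {set T} | #|A| == k)
   \sum_(B : {set T} | #|B| == k) Ex p G (fun E => (tstab t E A)%:R * (tstab t E B)%:R).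
  under [RHS]eq_bigr => A _ do rewrite -Ex_sum.
  rewrite -Ex_sum; apply: eq_Ex => E _; rewrite expr2 /nstab big_distrl; apply: eq_bigr => A _.
  by rewrite big_distrr.
rewrite big_distrr; apply: ler_sum => A /eqP Ak; rewrite big_distrr; apply: ler_sum => B _.
by rewrite -Ak; exact: joint_stab_prob.
Qed.
End StableProbability.

(** The difference of the binomials is [(k - l) * (k + l - 1) / 2], and [2 * l > k] makes
    [(k + l - 1) / 2] at least [(3 * k - 2) / 4]. *)
Lemma bin2_gap k l : (0 < k)%N -> (l <= k)%N -> (k < 2 * l)%N ->
  ((3 * k - 2) %/ 4 * (k - l) <= 'C(k, 2) - 'C(l, 2) <= k ^ 2)%N.
Proof.
move=> k0 lk kl; have := mul_bin_diag k 1; have := mul_bin_diag l 1; rewrite !bin1.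
move: ('C(k, 2)) ('C(l, 2)) => u v.
have [s ks] : exists s, k = (l + s)%N by exists (k - l)%N; lia.
have hg : (2 * ((3 * k - 2) %/ 4) <= 2 * l + s - 1)%N by lia.
have -> : (k - l = s)%N by lia.
move: hg; move: (_ %/ 4)%N => g hg hv hu.
have uv : (2 * (u - v) = s * (2 * l + s - 1))%N.
  by case: l ks hv hg lk kl => [|l'] ks /= hv hg lk kl; [lia|rewrite ks /= in hu; nia].
have := leq_mul (leqnn s) hg => h.
have uk : (u <= k ^ 2)%N by case: k hu {ks lk kl k0} => [|k'] /= hu; nia.
by apply/andP; split; lia.
Qed.

(** * Summation over the size of the overlap *)

Section SecondMoment.
Variables (R : realFieldType) (p : R) (t : nat).
Hypothesis p01 : 0 < p < 1.

Lemma stab_probn_gt0 k : 0 < stab_probn p t k.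
Proof.
apply: lt_le_trans (Ex_ge_empty p01 _ _); last by [].
have -> : tstab t set0 [set: 'I_k].
  apply/forall_inP => v _; rewrite /deg (_ : [set _ in _ | _] = set0) ?cards0 //.
  by apply/setP => u; rewrite !inE.
by rewrite mulr1 exprn_gt0 // subr_gt0; case/andP: p01.
Qed.

Lemma geometric_le (x : R) n : 0 <= x -> x <= 2^-1 -> \sum_(i < n) x ^+ i <= 2.
Proof.
move=> x0 x2; have h : (1 - x) * \sum_(i < n) x ^+ i <= 1.
  have := subrX1 x n => h.
  have -> : (1 - x) * \sum_(i < n) x ^+ i = 1 - x ^+ n by rewrite -[RHS]opprB h -mulNr opprB.
  by rewrite gerBl exprn_ge0.
have : 0 <= \sum_(i < n) x ^+ i by apply: sumr_ge0 => i _; rewrite exprn_ge0.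
by move: (\sum_(i < n) _) h => s h s0; nra.
Qed.

Variable T : finType.
Variables (k : nat) (K : R).
Let n := #|T|.
(* x and z are the ratios of the geometric series which bound the contributions
   of the sets B with #|A :&: B| <= k / 2 and #|A :&: B| > k / 2, respectively. *)
Let x : R := k%:R ^+ 2 / n%:R * (1 - p) ^- (k %/ 4).+1.
Let z : R := k%:R ^+ (2 * t).+1 * n%:R * (1 - p) ^+ ((3 * k - 2) %/ 4).
Hypothesis k_gt0 : (0 < k)%N.
Hypothesis k_le_n : (k <= n)%N.
Hypothesis K_ge : (1 + p / (1 - p) / k%:R ^+ 2) ^+ (k ^ 2) <= K.
Implicit Types A B : {set T}.

Let q1 : 0 < 1 - p. Proof. by rewrite subr_gt0; case/andP: p01. Qed.

(** For [l <= k / 2], ['C(l, 2) = l * (l - 1) / 2] is at most [(k %/ 4).+1 * l]: the exponent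
    becomes linear in [l], as a geometric series requires. *)
Let ext_small A B : #|A| = k -> #|B| = k -> (2 * #|A :&: B| <= k)%N ->
  ext_prob p t A B <= stab_probn p t k * (1 - p) ^- ((k %/ 4).+1 * #|A :&: B|).
Proof.
move=> Ak Bk lk; rewrite ler_pdivlMr ?exprn_gt0 //.
have := ext_prob_le_indep t p01 A B; rewrite Bk; apply: le_trans; rewrite ler_wpM2l //.
  by rewrite /ext_prob; apply: sumr_ge0 => E _; rewrite mulr_ge0 // ltW // pmass_gt0.
apply: ler_wiXn2l; rewrite ?(ltW q1) //.
  by rewrite gerBl ltW //; case/andP: p01.
move: #|A :&: B| lk => l lk.
have hd : (l.-1 <= 2 * (k %/ 4).+1)%N by lia.
by have := mul_bin_diag l 1; rewrite bin1; have := leq_mul (leqnn l) hd; lia.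
Qed.

Let ext_disjoint A B : #|B| = k -> (#|A :&: B| <= 1)%N -> ext_prob p t A B <= stab_probn p t k.
Proof.
move=> Bk l1; have := ext_prob_le_indep t p01 A B; rewrite Bk.
by rewrite bin_small ?expr0 ?mulr1.
Qed.

Let ext_large A B : #|A| = k -> #|B| = k -> (k < 2 * #|A :&: B|)%N ->
  ext_prob p t A B <=
    K * (k%:R ^+ (2 * t) * (1 - p) ^+ ((3 * k - 2) %/ 4)) ^+ (k - #|A :&: B|).
Proof.
move=> Ak Bk lk; set l := #|A :&: B| in lk *.
have lek : (l <= k)%N by rewrite -Ak subset_leq_card ?subsetIl.
(* Chernoff parameter: [y ^- (t * (k - l))] is then a mere power of [k], while [p * y + (1 - p)]
   exceeds [1 - p] only by the factor [1 + p / (1 - p) / k^2], whose powers of exponent at most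
   [k^2] are bounded by [K]. *)
set y : R := k%:R ^- 2.
have k1 : 1 <= k%:R :> R by rewrite ler1n.
have y0 : 0 < y by rewrite invr_gt0 exprn_gt0 // ltr0n.
have y1 : y <= 1 by rewrite invf_le1 ?exprn_gt0 ?ltr0n // exprn_ege1.
apply: le_trans (ext_prob_le_card t p01 A B y0 y1) _.
rewrite cardsD setIC -/l Bk.
have -> : p * y + (1 - p) = (1 - p) * (1 + p / (1 - p) / k%:R ^+ 2).
  by rewrite /y; field; rewrite (gt_eqF q1) pnatr_eq0 -lt0n k_gt0.
have -> : y ^- (t * (k - l)) = (k%:R ^+ (2 * t)) ^+ (k - l).
  by rewrite /y exprVn invrK -!exprM mulnA.
rewrite exprMn [in leRHS]exprMn [leRHS]mulrCA ler_wpM2l ?exprn_ge0 //.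
have /andP[D1 D2] := bin2_gap k_gt0 lek lk.
have w0 : 0 <= p / (1 - p) / k%:R ^+ 2.
  by rewrite !mulr_ge0 ?invr_ge0 ?exprn_ge0 ?(ltW q1) //; case/andP: p01 => /ltW.
rewrite mulrC; apply: ler_pM.
- by rewrite exprn_ge0 // addr_ge0.
- by rewrite exprn_ge0 // ltW.
- by apply: le_trans K_ge; apply: ler_weXn2l => //; rewrite lerDl.
- rewrite -exprM; apply: ler_wiXn2l => //; first exact: ltW.
  by rewrite gerBl ltW //; case/andP: p01.
Qed.

Let card_meet_real A l : #|A| = k -> (l <= k)%N ->
  #|[set B : {set T} | (#|B| == k) && (#|A :&: B| == l)]|%:R
    <= 'C(n, k)%:R * (k%:R ^+ 2 / n%:R) ^+ l :> R.
Proof.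
move=> Ak lk; have n0 : 0 < n%:R :> R by rewrite ltr0n (leq_trans k_gt0).
rewrite expr_div_n -exprM mulrA ler_pdivlMr ?exprn_gt0 // -!natrX -!natrM ler_nat.
by have := card_meet_le Ak lk; rewrite mul2n -addnn expnD [leqRHS]mulnC.
Qed.

(** Suited to large overlaps: [B] is given by the [k - l] points of [A] that it omits and the
    [k - l] points that it adds. *)
Let card_meet_real_compl A l : #|A| = k -> (l <= k)%N ->
  #|[set B : {set T} | (#|B| == k) && (#|A :&: B| == l)]|%:R
    <= (k%:R * n%:R) ^+ (k - l) :> R.
Proof.
move=> Ak lk; rewrite -natrM -natrX ler_nat; apply: leq_trans (card_meet l Ak) _.
rewrite expnMn -(bin_sub lk); apply: leq_mul; first exact: leq_bin_exp.
apply: leq_trans (leq_bin_exp _ _) _.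
by case: (k - l)%N => [|e] //; rewrite leq_exp2r // leq_subr.
Qed.

(** Every [B] is charged the unconditional probability [pi], for a total of [mean_stab]; overlaps
    between 2 and [k / 2] add a geometric series of ratio [x], and larger ones a series of ratio
    [z]. *)
Lemma sum_ext_prob A : #|A| = k -> x <= 2^-1 -> z <= 2^-1 ->
  \sum_(B : {set T} | #|B| == k) ext_prob p t A B
    <= mean_stab p t T k * (1 + 2 * x) + 2 * K.
Proof.
move=> Ak x2 z2; pose pi := stab_probn p t k; pose mu := mean_stab p t T k.
have pi0 : 0 < pi by exact: stab_probn_gt0.
have n0 : 0 < n%:R :> R by rewrite ltr0n (leq_trans k_gt0).
have x0 : 0 <= x by rewrite !mulr_ge0 ?invr_ge0 ?exprn_ge0 // ltW.
have z0 : 0 <= z by rewrite !mulr_ge0 ?exprn_ge0 // ltW.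
have K0 : 0 <= K.
  apply: le_trans K_ge; rewrite exprn_ge0 // addr_ge0 //.
  by rewrite !mulr_ge0 ?invr_ge0 ?exprn_ge0 ?(ltW q1) //; case/andP: p01 => /ltW.
have mu0 : 0 <= mu by rewrite mulr_ge0 // ltW.
(* An overlap of size at most 1 contains no pair, so [ext_disjoint] leaves no excess over [pi]. *)
pose a l : R := if (1 < l)%N then pi * (1 - p) ^- ((k %/ 4).+1 * l) else 0.
pose c l : R := K * (k%:R ^+ (2 * t) * (1 - p) ^+ ((3 * k - 2) %/ 4)) ^+ (k - l).
have a0 l : 0 <= a l.
  by rewrite /a; case: ifP => // _; rewrite mulr_ge0 ?invr_ge0 ?exprn_ge0 // ltW.
have c0 l : 0 <= c l by rewrite mulr_ge0 // exprn_ge0 // mulr_ge0 // exprn_ge0 // ltW.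
pose N l := #|[set B : {set T} | (#|B| == k) && (#|A :&: B| == l)]|.
have regroup (f : nat -> R) : \sum_(B : {set T} | #|B| == k) f #|A :&: B|
    = \sum_(l < k.+1) (N l)%:R * f l.
  rewrite (partition_big (fun B : {set T} => inord #|A :&: B| : 'I_k.+1) predT) //=.
  apply: eq_bigr => l _; rewrite /N -sum1_card natr_sum big_distrl /=.
  rewrite [RHS](eq_bigl (fun B : {set T} => (#|B| == k) && (#|A :&: B| == l))) => [|B];
    last by rewrite inE.
  have lk B : (#|A :&: B| < k.+1)%N by rewrite ltnS -Ak subset_leq_card ?subsetIl.
  apply: eq_big => [B|B /andP[_ /eqP <-]]; last by rewrite inordK ?mul1r.
  by congr (_ && _); apply/eqP/eqP => [<-|lE]; [rewrite inordK|apply/val_inj; rewrite /= inordK].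
apply: (@le_trans _ _ (\sum_(B : {set T} | #|B| == k) (pi + (a #|A :&: B| + c #|A :&: B|)))).
  apply: ler_sum => B /eqP Bk; have := a0 #|A :&: B|; have := c0 #|A :&: B|.
  case: (leqP #|A :&: B| 1) => [l1|l2].
    by have := ext_disjoint Bk l1; rewrite -/pi; lra.
  case: (leqP (2 * #|A :&: B|) k) => [lk|lk].
    by have := ext_small Ak Bk lk; rewrite /a l2 -/pi; lra.
  by have := ext_large Ak Bk lk; rewrite -/(c _); lra.
rewrite big_split big_split /= !regroup.
have -> : \sum_(B : {set T} | #|B| == k) pi = mu.
  rewrite sumr_const /mu /mean_stab mulr_natl -/pi; congr (_ *+ _).
  by rewrite -(card_draws T k) -sum1_card -[in RHS]sum1_card; apply: eq_bigl => S; rewrite !inE.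
rewrite -/mu mulrDr mulr1 -addrA lerD2l; apply: lerD.
  apply: (@le_trans _ _ (mu * x * \sum_(l < k) x ^+ l)); last first.
    have := geometric_le k x0 x2; set s := \sum_(l < k) _ => s2.
    by rewrite -mulrA ler_wpM2l // [leRHS]mulrC ler_wpM2l.
  rewrite big_ord_recl /a /= mulr0 add0r big_distrr; apply: ler_sum => l _ /=.
  rewrite /bump leq0n add1n ltnS; case: (posnP l) => [l0|l0].
    by rewrite l0 mulr0 expr0 mulr1 mulr_ge0.
  rewrite -mulrA -exprS /x [in leRHS]exprMn exprVn -exprM /mu /mean_stab -/pi.
  rewrite !mulrA ler_wpM2r ?invr_ge0 ?exprn_ge0 ?(ltW q1) //.
  by rewrite [leRHS]mulrAC ler_wpM2r ?(ltW pi0) // card_meet_real.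
apply: (@le_trans _ _ (K * \sum_(l < k.+1) z ^+ l)); last first.
  by rewrite [leRHS]mulrC ler_wpM2l // geometric_le.
(* The summation index becomes [k - #|A :&: B|], the number of points of [B] outside [A]. *)
rewrite (reindex_inj rev_ord_inj) big_distrr; apply: ler_sum => l _ /=.
have lk : (l <= k)%N by rewrite -ltnS.
rewrite /c subSS subKn // mulrCA ler_wpM2l //.
have := @card_meet_real_compl A (k - l) Ak (leq_subr _ _); rewrite subKn // -/(N _) => h.
have -> : z ^+ l = (k%:R * n%:R) ^+ l * (k%:R ^+ (2 * t) * (1 - p) ^+ ((3 * k - 2) %/ 4)) ^+ l.
  by rewrite -exprMn /z exprS; congr (_ ^+ _); ring.
by rewrite ler_wpM2r // exprn_ge0 // mulr_ge0 // exprn_ge0 // ltW.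
Qed.

(** The second moment is at most [mu * (mu * (1 + 2 * x) + 2 * K)]; Chebyshev's inequality subtracts
    [mu ^+ 2] and divides by it. *)
Lemma nostab_prob_le : x <= 2^-1 -> z <= 2^-1 ->
  Ex p (pairs [set: T]) (fun E => (nostab t k E)%:R) <= 2 * x + 2 * K / mean_stab p t T k.
Proof.
move=> x2 z2; set P0 := Ex _ _ _; set mu := mean_stab p t T k.
have Cn0 : 0 < 'C(n, k)%:R :> R by rewrite ltr0n bin_gt0.
have mu0 : 0 < mu by rewrite mulr_gt0 // stab_probn_gt0.
have := le_trans (chebyshev t p01 T k) (lerB (second_moment t p01 T k) (lexx _)).
rewrite -/mu -/P0 => cheb.
have : stab_probn p t k *
    (\sum_(A : {set T} | #|A| == k) \sum_(B : {set T} | #|B| == k) ext_prob p t A B)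
   <= mu * (mu * (1 + 2 * x) + 2 * K).
  rewrite {1}/mu /mean_stab [in leRHS]mulrAC mulrC ler_wpM2r ?(ltW (stab_probn_gt0 k)) //.
  apply: (@le_trans _ _ (\sum_(A : {set T} | #|A| == k) (mu * (1 + 2 * x) + 2 * K))).
    by apply: ler_sum => A /eqP Ak; exact: sum_ext_prob.
  rewrite sumr_const [leRHS]mulr_natl.
  rewrite -(card_draws T k) -sum1_card -[in leRHS]sum1_card.
  by rewrite (eq_bigl (fun S => S \in [set S : {set T} | #|S| == k])) // => S; rewrite !inE.
move=> h; have {h cheb} : mu ^+ 2 * P0 <= mu ^+ 2 * (2 * x + 2 * K / mu).
  apply: le_trans cheb _; rewrite lerBlDr; apply: le_trans h _.
  by rewrite le_eqVlt; apply/orP; left; apply/eqP; field; rewrite gt_eqF.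
by rewrite ler_pM2l // exprn_gt0.
Qed.
End SecondMoment.

(** * Asymptotics of the expected number of stable sets *)

Section Factorial.
Variable R : realType.

Lemma ln_nat_ge0 n : 0 <= ln (n%:R : R).
Proof. by case: n => [|n]; [rewrite ln0|apply: ln_ge0; rewrite ler1n]. Qed.

Lemma exprn_div_fact_le (x : R) n : 0 <= x -> x ^+ n / n`!%:R <= expR x.
Proof.
case: n => [|n] x0; first by rewrite expr0 divr1 -expR0 ler_expR.
by apply: le_trans (expR_ge1Dxn n x0); rewrite lerDr.
Qed.

(** The term [n^n / n!] of the exponential series at [n] is at most [e^n]. *)
Lemma ln_fact_ge n : n%:R * ln n%:R - n%:R <= ln (n`!%:R : R).
Proof.
case: (posnP n) => [->|n0]; first by rewrite mul0r subr0 fact0 ln1.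
have n0' : 0 < n%:R :> R by rewrite ltr0n.
have f0 : 0 < n`!%:R :> R by rewrite ltr0n fact_gt0.
have := exprn_div_fact_le n (ltW n0'); rewrite ler_pdivrMr // => h.
have : ln (n%:R ^+ n : R) <= ln (expR n%:R * n`!%:R).
  by rewrite ler_ln // posrE ?exprn_gt0 // mulr_gt0 // expR_gt0.
by rewrite lnXn // lnM ?posrE ?expR_gt0 // expRK -[_ *+ _]mulr_natl => {}h; lra.
Qed.

(** The induction step rests on [ln (1 - 1 / (n + 2)) <= - 1 / (n + 2)]. With [ln_fact_ge], this is
    Stirling's formula up to [1 + ln n]. *)
Lemma ln_fact_le n : (0 < n)%N -> ln (n`!%:R : R) <= n%:R * ln n%:R - n%:R + 1 + ln n%:R.
Proof.
elim: n => // -[_ _|n IH _]; first by rewrite factS fact0 ln1; lra.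
rewrite factS natrM lnM ?posrE ?ltr0n ?fact_gt0 //; have := IH isT.
have n1 : 0 < n.+1%:R :> R by rewrite ltr0n.
have n2 : 0 < n.+2%:R :> R by rewrite ltr0n.
have : ln (n.+1%:R / n.+2%:R : R) <= - n.+2%:R^-1.
  have -> : n.+1%:R / n.+2%:R = 1 + (- n.+2%:R^-1) :> R.
    by rewrite -[X in X / _ = _](addrK 1) natr1 mulrBl divff ?gt_eqF // mul1r.
  by apply: le_ln1Dx; rewrite ltrN2 invf_lt1 // ltr1n.
rewrite ln_div ?posrE // -(ler_pM2l n2) mulrN divff ?gt_eqF //.
have -> : n.+2%:R = n.+1%:R + 1 :> R by rewrite natr1.
by move: (ln _) (ln _) (ln _) => a b c; nra.
Qed.
End Factorial.

(** * Weighted count of the stable graphs on a given vertex set *)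

Section WeightedCount.
Variables (R : realType) (t : nat) (q : R) (T : finType) (S : {set T}).
Hypothesis q_gt0 : 0 < q.
Let M := (#|S| * t)%N.

Definition wcount : R :=
  \sum_(E : {set {set T}} | (E \subset pairs S) && tstab t E S) q ^+ #|E|.

(** With [s = M - 2 * m], the bound [M! / (m! 2^m s!)] on the number of matchings yields [M! x^-M]
    times [(q x^2 / 2)^m / m!] and [(t! x)^s / s!], two terms of exponential series. *)
Lemma num_matchings_upper_real m (x : R) : 0 < x -> (2 * m <= M)%N ->
  q ^+ m * t`!%:R ^+ (M - 2 * m) * (num_matchings t S m)%:R
    <= M`!%:R * x ^- M * expR (q * x ^+ 2 / 2 + t`!%:R * x).
Proof.
move=> x0 mM; have := num_matchings_upper mM; rewrite -/M => h.
have C0 : 0 < t`!%:R :> R by rewrite ltr0n fact_gt0.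
have f0 i : 0 < i`!%:R :> R by rewrite ltr0n fact_gt0.
have hN : (num_matchings t S m)%:R <= M`!%:R / (m`!%:R * 2 ^+ m * (M - 2 * m)`!%:R) :> R.
  rewrite ler_pdivlMr ?mulr_gt0 // ?exprn_gt0 //.
  by rewrite !mulrA -natrX -!natrM ler_nat.
have [s Ms] : exists s, (M = 2 * m + s)%N by exists (M - 2 * m)%N; lia.
have -> : (M - 2 * m = s)%N by lia.
apply: (@le_trans _ _ (q ^+ m * t`!%:R ^+ s * (M`!%:R / (m`!%:R * 2 ^+ m * (M - 2 * m)`!%:R)))).
  by rewrite ler_wpM2l // mulr_ge0 // exprn_ge0 // ltW.
have -> : (M - 2 * m = s)%N by lia.
have -> : q ^+ m * t`!%:R ^+ s * (M`!%:R / (m`!%:R * 2 ^+ m * s`!%:R)) =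
   M`!%:R * x ^- M * (((q * x ^+ 2 / 2) ^+ m / m`!%:R) * ((t`!%:R * x) ^+ s / s`!%:R)).
  rewrite Ms exprD exprM !exprMn !exprVn.
  by field; rewrite !gt_eqF ?exprn_gt0.
rewrite expRD ler_wpM2l //; first by rewrite mulr_ge0 // invr_ge0 exprn_ge0 // ltW.
apply: ler_pM; rewrite ?divr_ge0 ?exprn_ge0 ?mulr_ge0 ?(ltW x0) ?(ltW q_gt0) //.
  by apply: exprn_div_fact_le; rewrite !mulr_ge0 ?exprn_ge0 ?(ltW x0) ?(ltW q_gt0).
by apply: exprn_div_fact_le; rewrite mulr_ge0 // ltW.
Qed.

(* Each term is bounded by its contribution to a product of exponential series
   in x; the optimal x, of order sqrt M, is substituted in ln_wcount_upper. *)
Lemma wcount_upper (x : R) : 0 < x ->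
  wcount * t`!%:R ^+ #|S| <=
    M.+1%:R * (M`!%:R * x ^- M * expR (q * x ^+ 2 / 2 + t`!%:R * x)).
Proof.
move=> x0; set Y := _ * _ * expR _.
have C0 : 0 < t`!%:R :> R by rewrite ltr0n fact_gt0.
have EM (E : {set {set T}}) : E \subset pairs S -> tstab t E S -> (2 * #|E| <= M)%N.
  by move=> ES st; rewrite /M -(sum_slack ES st) leq_addl.
have EM' (E : {set {set T}}) : E \subset pairs S -> tstab t E S -> (#|E| < M.+1)%N.
  by move=> ES st; rewrite ltnS (leq_trans _ (EM E ES st)) // leq_pmull.
apply: (@le_trans _ _ (\sum_(m < M.+1 | (2 * m <= M)%N)
   q ^+ m * t`!%:R ^+ (M - 2 * m) * (num_matchings t S m)%:R)); last first.
  apply: (@le_trans _ _ (\sum_(m < M.+1 | (2 * m <= M)%N) Y)).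
    by apply: ler_sum => m mM; exact: num_matchings_upper_real.
  have Y0 : 0 <= Y by rewrite !mulr_ge0 ?invr_ge0 ?exprn_ge0 ?expR_ge0 // ltW.
  rewrite sumr_const -[leLHS]mulr_natl ler_wpM2r // ler_nat.
  by apply: leq_trans (max_card _) _; rewrite card_ord.
rewrite /wcount big_distrl /=.
rewrite (partition_big (fun E : {set {set T}} => inord #|E| : 'I_M.+1)
   (fun m : 'I_M.+1 => (2 * m <= M)%N)) /=; last first.
  move=> E /andP[ES st]; by rewrite inordK ?EM ?EM'.
apply: ler_sum => m mM; rewrite /num_matchings natr_sum big_distrr /=.
rewrite big_mkcond [leRHS]big_mkcond; apply: ler_sum => E _.
have nn (b : bool) : 0 <= if b then q ^+ m * t`!%:R ^+ (M - 2 * m) * (degw t S E)%:R else 0 :> R.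
  by case: b; rewrite // !mulr_ge0 ?exprn_ge0 // ltW.
case: ifP => // /andP[/andP[ES st] /eqP Em].
have hE : #|E| = m by rewrite -Em inordK ?EM'.
rewrite ES hE eqxx /= -mulrA ler_wpM2l ?exprn_ge0 ?(ltW q_gt0) // mulrC.
by rewrite -!natrX -natrM ler_nat -hE degw_ge.
Qed.

(** Only the graphs with [m] edges are kept, and each has weight [degw] at most [t! ^ #|S|]. *)
Lemma wcount_lower m (L := (M - t * t.+1)%N) : (2 * m <= L)%N ->
  q ^+ m * (L`!%:R / (m`!%:R * 2 ^+ m * (L - 2 * m)`!%:R)) <= wcount * t`!%:R ^+ #|S|.
Proof.
move=> mL; have := num_matchings_lower mL; rewrite -/L => h.
apply: (@le_trans _ _ (q ^+ m * (num_matchings t S m)%:R)).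
  rewrite ler_wpM2l ?exprn_ge0 ?(ltW q_gt0) // ler_pdivrMr; last first.
    by rewrite !mulr_gt0 ?exprn_gt0 // ltr0n fact_gt0.
  by rewrite !mulrA -natrX -!natrM ler_nat.
rewrite /wcount /num_matchings natr_sum big_distrl big_distrr /=.
rewrite big_mkcond [leRHS]big_mkcond; apply: ler_sum => E _.
have w0 : 0 <= q ^+ #|E| * t`!%:R ^+ #|S| :> R by rewrite !mulr_ge0 ?exprn_ge0 // ltW.
case: (boolP (tstab t E S)) => [st|]; last first.
  by rewrite tstab_degw negbK => /eqP ->; rewrite mulr0 andbF; case: ifP.
rewrite andbT; case: (E \subset pairs S) => //=; case: eqP => [<-|_] //.
by rewrite ler_wpM2l ?exprn_ge0 ?(ltW q_gt0) // -natrX ler_nat degw_le.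
Qed.
End WeightedCount.

(** A graph with [e] of the [C = 'C(k, 2)] possible edges has mass
    [p^e (1 - p)^(C - e) = (1 - p)^C q^e], where [q = p / (1 - p)]. *)
Lemma stab_probE_wcount (R : realType) (p : R) t k : 0 < p < 1 ->
  stab_probn p t k = (1 - p) ^+ 'C(k, 2) * wcount t (p / (1 - p)) [set: 'I_k].
Proof.
move=> /andP[p0 p1]; have q1 : 1 - p != 0 by rewrite subr_eq0 gt_eqF.
rewrite /stab_probn /stab_prob /Ex /wcount big_distrr /= big_mkcondr /=.
apply: eq_bigr => E EP; case: (tstab t E _); rewrite ?mulr0 // mulr1.
rewrite /pmass prod_if_mem // -[in 'C(k, 2)](card_ord k) -cardsT -card_pairs.
have cE : #|pairs [set: 'I_k]| = (#|E| + #|pairs [set: 'I_k] :\: E|)%N.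
  by rewrite -(cardsID E) (setIidPr EP).
by rewrite cE exprD expr_div_n mulrAC mulrCA divff ?expf_neq0 // mulr1.
Qed.

(** * Logarithmic asymptotics of the weighted count *)

Section WeightedCountAsymptotics.
Variables (R : realType) (t : nat) (q : R).
Hypothesis q_gt0 : 0 < q.

Lemma ln_le_sqrt (x : R) : 0 < x -> ln x <= 2 * Num.sqrt x.
Proof.
move=> x0; rewrite -[X in ln X](sqr_sqrtr (ltW x0)) lnXn ?sqrtr_gt0 // -[_ *+ 2]mulr_natl.
by rewrite ler_wpM2l // ltW // ln_sublinear // sqrtr_gt0.
Qed.

(** The factor [t! ^ k] coming from the weights is kept inside; [ln_mean_asymp] takes it out. *)
Definition ln_wcount (k : nat) : R := ln (wcount t q [set: 'I_k] * t`!%:R ^+ k).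
Definition ln_wcount_main (k : nat) : R :=
  (k * t)%:R / 2 * (ln (k * t)%:R - 1 + ln q).

Lemma wcount_gt0 (k : nat) : 0 < wcount t q [set: 'I_k].
Proof.
have st0 : tstab t set0 [set: 'I_k].
  apply/forall_inP => v _; rewrite /deg (_ : [set _ in _ | _] = finset.set0) ?cards0 //.
  by apply/setP => u; rewrite !inE.
rewrite /wcount (bigD1 finset.set0) /= ?sub0set ?st0 // cards0 expr0.
by rewrite ltr_pwDl // sumr_ge0 // => E _; rewrite exprn_ge0 // ltW.
Qed.

Let f_gt0 i : 0 < i`!%:R :> R. Proof. by rewrite ltr0n fact_gt0. Qed.

Lemma ln_wcount_upper k (s : R := Num.sqrt (k * t)%:R) : (0 < k * t)%N ->
  ln_wcount k <= ln_wcount_main k + (6 + t`!%:R / Num.sqrt q) * s.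
Proof.
rewrite /ln_wcount_main; set M := (k * t)%N in s * => M0.
have M0' : 0 < M%:R :> R by rewrite ltr0n.
have s1 : 1 <= s by rewrite -[leLHS]sqrtr1 ler_wsqrtr // ler1n.
have s0 : 0 < s by apply: lt_le_trans s1.
have sq0 : 0 < Num.sqrt q by rewrite sqrtr_gt0.
(* With [q * x^2 = M], the exponential contributes [M / 2 + O(sqrt M)], and [M! x^-M] contributes
   [M / 2 * (ln M + ln q) - M] up to [O(ln M)]. *)
pose x := s / Num.sqrt q; have x0 : 0 < x by rewrite divr_gt0.
have := wcount_upper t [set: 'I_k] q_gt0 x0; rewrite !cardsT !card_ord -/M => h.
have {h} : ln_wcount k <= ln (M.+1%:R * (M`!%:R * x ^- M * expR (q * x ^+ 2 / 2 + t`!%:R * x))).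
  rewrite /ln_wcount ler_ln ?posrE ?mulr_gt0 ?wcount_gt0 ?exprn_gt0 ?invr_gt0 ?exprn_gt0 //.
  by rewrite expR_gt0.
rewrite !lnM ?posrE ?mulr_gt0 ?invr_gt0 ?exprn_gt0 ?expR_gt0 //.
rewrite lnV ?posrE ?exprn_gt0 // lnXn // expRK -[ln x *+ _]mulr_natl.
have -> : q * x ^+ 2 = M%:R.
  rewrite /x expr_div_n /s !sqr_sqrtr ?ltW //; field; exact: lt0r_neq0.
have -> : ln x = (ln M%:R - ln q) / 2.
  have := lnXn 2 x0; rewrite /x expr_div_n /s !sqr_sqrtr ?(ltW q_gt0) // ln_div ?posrE //.
  by rewrite -[_ *+ 2]mulr_natr => ->; rewrite mulfK.
have := ln_fact_le R M0; have := ln_le_sqrt M0'; rewrite -/s.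
have : ln (M.+1%:R : R) <= 1 + ln M%:R.
  have : ln (M.+1%:R : R) <= ln (expR 1 * M%:R).
    rewrite ler_ln ?posrE ?mulr_gt0 ?expR_gt0 //; apply: (@le_trans _ _ (2 * M%:R)).
      by rewrite -natrM ler_nat; lia.
    by rewrite ler_wpM2r // (le_trans _ (expR_ge1Dx 1)).
  by rewrite lnM ?posrE ?expR_gt0 // expRK.
rewrite /x [in _ * (s / _)]mulrA [_ * s / _]mulrAC; lra.
Qed.

Lemma ln_wcount_lower k (s : R := Num.sqrt (k * t)%:R) : (t * t.+1 + 2 <= k * t)%N ->
  ln_wcount_main k - ((t * t.+1)%:R * (2 + `|ln q|) + `|ln q| + 4) * s <= ln_wcount k.
Proof.
rewrite /ln_wcount_main /ln_wcount; set M := (k * t)%N in s *; set c := (t * t.+1)%N => cM.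
have M0' : 0 < M%:R :> R by rewrite ltr0n; lia.
have s1 : 1 <= s by rewrite -[leLHS]sqrtr1 ler_wsqrtr // ler1n; lia.
(* Nearly all half-edges are matched: [L - 2 * m] is 0 or 1, so its factorial is 1. *)
pose L := (M - c)%N; pose m := L./2.
have mL : (2 * m <= L)%N by rewrite /m; lia.
have := @wcount_lower R t q _ [set: 'I_k] q_gt0 m.
rewrite cardsT card_ord -/M -/c -/L => /(_ mL).
have -> : ((L - 2 * m)`! = 1)%N.
  have : (L - 2 * m <= 1)%N by rewrite /m; lia.
  by case: (L - 2 * m)%N => [|[]].
rewrite mulr1 => h.
have m0 : (0 < m)%N by rewrite /m /L; lia.
have m0' : 0 < m%:R :> R by rewrite ltr0n.
have L0' : 0 < L%:R :> R by rewrite ltr0n; lia.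
have {h} : ln (q ^+ m * (L`!%:R / (m`!%:R * 2 ^+ m))) <= ln (wcount t q [set: 'I_k] * t`!%:R ^+ k).
  by rewrite ler_ln ?posrE ?mulr_gt0 ?invr_gt0 ?mulr_gt0 ?wcount_gt0 ?exprn_gt0.
apply: le_trans.
rewrite lnM ?posrE ?mulr_gt0 ?invr_gt0 ?mulr_gt0 ?exprn_gt0 //.
rewrite ln_div ?posrE ?mulr_gt0 ?exprn_gt0 // lnM ?posrE ?exprn_gt0 //.
rewrite !lnXn // -[ln q *+ _]mulr_natl -[ln 2 *+ _]mulr_natl.
have := ln_fact_le R m0; have := ln_fact_ge R L; have := ln_le_sqrt M0'; rewrite -/s.
have mLR : 2 * m%:R <= L%:R :> R by rewrite -natrM ler_nat.
have mLR' : L%:R <= 2 * m%:R + 1 :> R by rewrite -natrM natr1 ler_nat /m; lia.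
have lm : ln m%:R + ln 2 <= ln L%:R :> R.
  by rewrite addrC -lnM ?posrE // ler_ln ?posrE ?mulr_gt0.
have MLc : M%:R = L%:R + c%:R :> R by rewrite -natrD /L subnK //; lia.
(* Replacing [ln M] by [ln L] costs only a constant, as [ln (1 + c / L) <= c / L]. *)
have lML : L%:R * (ln M%:R - ln L%:R) <= c%:R :> R.
  rewrite -ln_div ?posrE // MLc mulrDl divff ?gt_eqF //.
  rewrite mulrC -ler_pdivlMr //; apply: le_ln1Dx.
  by apply: lt_le_trans (_ : 0 <= _); rewrite ?divr_ge0 // ltW.
have lL0 := ln_nat_ge0 R L; have l20 := ln_nat_ge0 R 2; have lm0 := ln_nat_ge0 R m.
have lLM : ln L%:R <= ln M%:R :> R by rewrite ler_ln ?posrE // ler_nat leq_subr.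
have c0 : 0 <= c%:R :> R by [].
rewrite MLc in lML lLM *.
move: (ler_norm (ln q)) (ler_norm (- ln q)); rewrite normrN.
move: lLM lML lm mLR mLR' lL0 l20 lm0.
move: (ln L`!%:R) (ln m`!%:R) (ln (L%:R + c%:R)) (ln L%:R) (ln m%:R) (ln 2) (ln q) `|ln q|.
have s0 : 0 <= s by apply: le_trans s1.
move: s s0 s1 => s s0 s1.
move: (L%:R) (m%:R) (c%:R) L0' m0' c0 => L' m' c' L0 m0' c0.
clear L m c M M0' cM mL m0 MLc.
move: L' m' c' L0 m0' c0 => L m c L0 m0 c0.
move=> lLf lmf lM lL lm l2 lq alq lLM lML hlm mL1 mL2 lL0 l20 lm0 alq1 alq2 lMs hLf hmf.
have e1 : m * (lm + l2) <= m * lL by rewrite ler_wpM2l // ltW.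
have e2 : 0 <= (L - 2 * m) * lL by rewrite mulr_ge0 // subr_ge0.
have alq0 : 0 <= alq by lra.
have e3 : (L - 2 * m) * lq <= alq.
  by apply: (@le_trans _ _ ((L - 2 * m) * alq)); [rewrite ler_wpM2l // subr_ge0|nra].
have e4 : c * lM <= c * (2 * s) by rewrite ler_wpM2l.
have e5 : c * lq <= c * alq by rewrite ler_wpM2l.
have e6 : c <= c * s by rewrite ler_peMr.
have e7 : c * alq <= c * alq * s by rewrite ler_peMr // mulr_ge0.
have e8 : alq <= alq * s by rewrite ler_peMr.
nra.
Qed.

Lemma ln_wcount_asymp : exists D : R, 0 <= D /\ forall k, (t + 3 <= k)%N ->
  `|ln_wcount k - ln_wcount_main k| <= D * Num.sqrt k%:R.
Proof.
have C0 : 0 <= t`!%:R / Num.sqrt q by rewrite divr_ge0 // sqrtr_ge0.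
(* For [t = 0] the main term is zero; the bounds with [x = 1] and [m = 0] already place [ln_wcount]
   between 0 and a constant. *)
case: (posnP t) => [t0|t0].
  exists (q / 2 + 1); split; first by rewrite addr_ge0 // divr_ge0 // ltW.
  move=> k k3; rewrite /ln_wcount_main t0 muln0 !mul0r subr0.
  have k1 : 1 <= Num.sqrt k%:R :> R by rewrite -[leLHS]sqrtr1 ler_wsqrtr // ler1n; lia.
  have W0 : 0 < wcount t q [set: 'I_k] * t`!%:R ^+ k by rewrite mulr_gt0 ?wcount_gt0 ?exprn_gt0.
  have up := wcount_upper t [set: 'I_k] q_gt0 ltr01.
  have low := @wcount_lower R t q _ [set: 'I_k] q_gt0 0 (leq0n _).
  have kt : (k * t = 0)%N by rewrite t0 muln0.
  have tf : (t`! = 1)%N by rewrite t0.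
  rewrite cardsT card_ord kt fact0 in up; rewrite cardsT card_ord in low.
  have {}low : 0 <= ln_wcount k.
    rewrite /ln_wcount ln_ge0 //; apply: le_trans low.
    by rewrite !expr0 muln0 subn0 mul1r fact0 mulr1 mul1r divff // gt_eqF.
  have {}up : ln_wcount k <= q / 2 + 1.
    rewrite -[leRHS]expRK ler_ln ?posrE ?expR_gt0 //; apply: le_trans up _.
    by rewrite expr0 invr1 !mul1r expr1n !mulr1 tf.
  by rewrite ger0_norm //; apply: (le_trans up); rewrite ler_peMr // addr_ge0 // divr_ge0 // ltW.
set D1 := 6 + t`!%:R / Num.sqrt q.
set D2 := (t * t.+1)%:R * (2 + `|ln q|) + `|ln q| + 4.
have D10 : 0 <= D1 by rewrite addr_ge0.
have D20 : 0 <= D2 by rewrite !addr_ge0 // mulr_ge0 // addr_ge0.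
exists ((D1 + D2) * Num.sqrt t%:R); split; first by rewrite mulr_ge0 ?sqrtr_ge0 // addr_ge0.
move=> k k3; have sE : Num.sqrt (k * t)%:R = Num.sqrt t%:R * Num.sqrt k%:R :> R.
  by rewrite natrM sqrtrM // mulrC.
have s0 : 0 <= Num.sqrt (k * t)%:R :> R by rewrite sqrtr_ge0.
have kt0 : (0 < k * t)%N by rewrite muln_gt0 t0 andbT; lia.
have up := ln_wcount_upper kt0.
(* From [k >= t + 3] and [t >= 1]: [k * t >= t^2 + 3 * t >= t * (t + 1) + 2]. *)
have low : (t * t.+1 + 2 <= k * t)%N by nia.
have {}low := ln_wcount_lower low.
rewrite -mulrA -sE mulrDl; rewrite -/D1 in up; rewrite -/D2 in low.
have h1 : 0 <= D1 * Num.sqrt (k * t)%:R by rewrite mulr_ge0.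
have h2 : 0 <= D2 * Num.sqrt (k * t)%:R by rewrite mulr_ge0.
by rewrite ler_norml; apply/andP; split; lra.
Qed.
End WeightedCountAsymptotics.

(** [(n - k)^k <= n ^_ k <= n^k], where the logarithms of the outer terms differ by at most
    [2 * k^2 / n] since [2 * k <= n]; the bounds on [ln k!] add [O(sqrt k)]. *)
Lemma ln_bin_asymp (R : realType) (n k : nat) : (0 < k)%N -> (2 * k <= n)%N ->
  `|ln ('C(n, k)%:R : R) - (k%:R * ln n%:R - k%:R * ln k%:R + k%:R)|
    <= 3 * Num.sqrt k%:R + 2 * k%:R ^+ 2 / n%:R.
Proof.
move=> k0 kn; have k0' : 0 < k%:R :> R by rewrite ltr0n.
have n0' : 0 < n%:R :> R by rewrite ltr0n; lia.
have nk0 : 0 < (n - k)%:R :> R by rewrite ltr0n; lia.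
have f0 : 0 < k`!%:R :> R by rewrite ltr0n fact_gt0.
have C0 : 0 < 'C(n, k)%:R :> R by rewrite ltr0n bin_gt0; lia.
have s1 : 1 <= Num.sqrt k%:R :> R by rewrite -[leLHS]sqrtr1 ler_wsqrtr // ler1n.
have e0 : 0 <= 2 * k%:R ^+ 2 / n%:R :> R by rewrite divr_ge0 // mulr_ge0 // sqr_ge0.
have lnCf : ln ('C(n, k)%:R : R) + ln k`!%:R = ln (n ^_ k)%:R.
  by rewrite -lnM ?posrE // -natrM bin_ffact.
have up : ln ((n ^_ k)%:R : R) <= k%:R * ln n%:R.
  rewrite mulr_natl -lnXn // ler_ln ?posrE ?exprn_gt0 ?ltr0n ?ffact_gt0 //; [|lia|lia].
  rewrite -natrX ler_nat; elim: (k) => [|m IH] //.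
  by rewrite ffactnSr expnSr leq_mul // leq_subr.
have low : k%:R * ln (n - k)%:R <= ln ((n ^_ k)%:R : R).
  rewrite mulr_natl -lnXn // ler_ln ?posrE ?exprn_gt0 ?ltr0n ?ffact_gt0 //; [|lia|lia].
  rewrite -natrX ler_nat.
  have : forall m, (m <= k -> (n - k) ^ m <= n ^_ m)%N; last exact.
  elim=> [|m IH] // mk; rewrite ffactnSr expnSr; apply: leq_mul; [apply: IH|]; lia.
have lnk : ln (n%:R : R) - ln (n - k)%:R <= 2 * k%:R / n%:R.
  rewrite -ln_div ?posrE //.
  have -> : n%:R / (n - k)%:R = 1 + k%:R / (n - k)%:R :> R.
    by rewrite -[X in X + _](divff (lt0r_neq0 nk0)) -mulrDl -natrD subnK //; lia.
  apply: le_trans (le_ln1Dx _) _; first by apply: (@lt_le_trans _ _ 0) => //; rewrite divr_ge0.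
  rewrite ler_pdivrMr // mulrAC ler_pdivlMr // [leRHS]mulrAC mulrC ler_wpM2r //.
  by rewrite -natrM ler_nat; lia.
have lnk' : k%:R * (ln (n%:R : R) - ln (n - k)%:R) <= 2 * k%:R ^+ 2 / n%:R.
  apply: le_trans (_ : k%:R * (2 * k%:R / n%:R) <= _); first by rewrite ler_wpM2l.
  by rewrite le_eqVlt; apply/orP; left; apply/eqP; rewrite expr2; ring.
have := ln_fact_ge R k; have := ln_fact_le R k0; have := ln_le_sqrt k0' => h1 h2 h3.
by rewrite ler_norml; apply/andP; split; lra.
Qed.

(** * Logarithm of the expected number of stable sets *)

Section MeanAsymptotics.
Variables (R : realType) (p : R) (t : nat).
Hypothesis p01 : 0 < p < 1.
Let lb : R := ln (1 - p)^-1.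

Lemma lnb_gt0 : 0 < lb.
Proof.
by case/andP: p01 => p0 p1; rewrite ln_gt0 // invf_gt1 ?subr_gt0 // gtrBl.
Qed.

(** The factors 2 in the constants of the threshold are moved into the iterated logarithm, giving
    [ln (2 log_b n)], which is comparable to [ln k] at the critical size. *)
Lemma alpha_tpE n : (2 <= n)%N -> alpha_tp t p n * lb =
  2 * ln n%:R + (t%:R - 2) * ln (2 * (ln n%:R / lb))
  + t%:R * (ln t%:R + ln (p / (1 - p)) - 1) - 2 * ln t`!%:R + 2 + lb.
Proof.
move=> n2; case/andP: p01 => p0 p1; have q1 : 0 < 1 - p by rewrite subr_gt0.
have lb0 := lnb_gt0.
have ln0 : 0 < ln n%:R :> R by rewrite ln_gt0 // ltr1n.
have f0 : 0 < t`!%:R :> R by rewrite ltr0n fact_gt0.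
have l0 : 0 < ln n%:R / lb by rewrite divr_gt0.
have tt0 : 0 < (t ^ t)%N%:R :> R by rewrite ltr0n expn_gt0; case: (t).
rewrite /alpha_tp /logb -/lb.
rewrite [ln ((t ^ t)%:R / _)]ln_div ?posrE // ?ltr0n ?expn_gt0 ?fact_gt0 //.
rewrite [(t`! ^ 2)%:R]natrX lnXn // [ln (expR 1 / 2)]ln_div ?posrE ?expR_gt0 // expRK.
rewrite [ln (2 * (1 - p)^-1 * p / _)]ln_div ?posrE ?expR_gt0 ?mulr_gt0 ?invr_gt0 // expRK.
have -> : ln (2 * (1 - p)^-1 * p) = ln 2 + ln (p / (1 - p)).
  by rewrite -lnM ?posrE ?divr_gt0 //; congr ln; ring.
have -> : ln (2 * (ln n%:R / lb)) = ln 2 + ln (ln n%:R / lb) by rewrite lnM ?posrE.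
(* For [t = 0] the left side is [ln 1], since [0 ^ 0 = 1], and the right side has the factor 0. *)
have -> : ln ((t ^ t)%N%:R : R) = t%:R * ln t%:R.
  case: (t) => [|t']; first by rewrite expn0 ln1 mul0r.
  by rewrite natrX lnXn // mulr_natl.
rewrite -[ln _ *+ 2]mulr_natl; move: (ln (ln n%:R / lb)) (ln (p / (1 - p))) => u v.
by field; rewrite gt_eqF.
Qed.

(** The last term of the bracket replaces [ln (2 log_b n)], built into the threshold, by [ln k]; it
    tends to 0 when [k] is asymptotic to [2 log_b n]. *)
Definition ln_mean_main n k : R := k%:R / 2 *
  ((alpha_tp t p n - k%:R) * lb + (t%:R - 2) * (ln k%:R - ln (2 * (ln n%:R / lb)))).

Lemma ln_mean_asymp : exists D : R, 0 <= D /\ forall n k, (t + 3 <= k)%N -> (2 * k <= n)%N ->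
  `|ln (mean_stab p t 'I_n k) - ln_mean_main n k| <= D * Num.sqrt k%:R + 2 * k%:R ^+ 2 / n%:R.
Proof.
case/andP: p01 => p0 p1; have q1 : 0 < 1 - p by rewrite subr_gt0.
have q0 : 0 < p / (1 - p) by rewrite divr_gt0.
have [D [D0 HD]] := ln_wcount_asymp t q0.
exists (D + 3); split; first by rewrite addr_ge0.
move=> n k tk kn; have := HD k tk; have k0 : (0 < k)%N by lia.
have := @ln_bin_asymp R n k k0 kn.
have k0' : 0 < k%:R :> R by rewrite ltr0n.
have f0 : 0 < t`!%:R :> R by rewrite ltr0n fact_gt0.
have C0 : 0 < 'C(n, k)%:R :> R by rewrite ltr0n bin_gt0; lia.
have W0 := wcount_gt0 t q0 k.
have -> : ln (mean_stab p t 'I_n k) = ln 'C(n, k)%:R - (k%:R * (k%:R - 1)) / 2 * lb +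
    (ln_wcount t (p / (1 - p)) k - k%:R * ln t`!%:R).
  rewrite /mean_stab card_ord stab_probE_wcount // /ln_wcount.
  rewrite !lnM ?posrE ?mulr_gt0 ?exprn_gt0 // !lnXn // /lb lnV ?posrE //.
  rewrite -[_ *+ 'C(k, 2)]mulr_natl -[_ *+ k]mulr_natl.
  have -> : 'C(k, 2)%:R = k%:R * (k%:R - 1) / 2 :> R.
    have := mul_bin_diag k 1; rewrite bin1 => /(congr1 (fun m => m%:R : R)).
    rewrite !natrM -[X in _ = X%:R * _]/2%N => h.
    have -> : k%:R - 1 = k.-1%:R :> R by rewrite -[in LHS](prednK k0) -natr1 addrK.
    by rewrite h mulrC mulKf.
  ring.
have -> : ln_wcount_main t (p / (1 - p)) k =
   k%:R / 2 * (t%:R * (ln k%:R + ln t%:R + ln (p / (1 - p)) - 1)).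
  rewrite /ln_wcount_main; case: (posnP t) => [->|t0]; first by rewrite muln0; ring.
  by rewrite natrM [ln (k%:R * _)]lnM ?posrE ?ltr0n //; ring.
have -> : ln_mean_main n k = k%:R * ln n%:R - k%:R * ln k%:R + k%:R
   - (k%:R * (k%:R - 1)) / 2 * lb - k%:R * ln t`!%:R
   + k%:R / 2 * (t%:R * (ln k%:R + ln t%:R + ln (p / (1 - p)) - 1)).
  by rewrite /ln_mean_main mulrBl alpha_tpE; [field|lia].
rewrite !ler_norml => /andP[a1 a2] /andP[b1 b2].
by apply/andP; split; lra.
Qed.
End MeanAsymptotics.

(** * Sizes at bounded distance from the threshold *)

Section Limits.
Variable R : realType.
Implicit Types u v : nat -> R.

Lemma cvg_dist_le u v (a : R) : (v n @[n --> \oo] --> (0 : R))%classic ->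
  (\forall n \near \oo, `|u n - a| <= v n)%classic -> (u n @[n --> \oo] --> a)%classic.
Proof.
move=> /cvgr0Pnorm_le v0 uv; apply/cvgrPdist_le => e e0.
near=> n; rewrite distrC; apply: (@le_trans _ _ (v n)); first by near: n.
by apply: (le_trans (ler_norm _)); near: n; exact: v0.
Unshelve. all: by end_near. Qed.

Lemma cvg_near_eq u v (a : R) : (v n @[n --> \oo] --> a)%classic ->
  (\forall n \near \oo, u n = v n)%classic -> (u n @[n --> \oo] --> a)%classic.
Proof.
move=> /cvgrPdist_le va uv; apply/cvgrPdist_le => e e0; near=> n.
have -> : u n = v n by near: n.
by near: n; exact: va.
Unshelve. all: by end_near. Qed.

Lemma cvg_ln_natr : (ln (n%:R : R) @[n --> \oo] --> +oo)%classic.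
Proof.
apply/cvgryPge => A; near=> n.
have nA : expR A <= n%:R by near: n; exact: nbhs_infty_ger.
by rewrite -(expRK A) ler_ln ?posrE ?expR_gt0 // (lt_le_trans (expR_gt0 A)).
Unshelve. all: by end_near. Qed.

Lemma near_ge u (A : R) : (u n @[n --> \oo] --> +oo)%classic ->
  (\forall n \near \oo, A <= u n)%classic.
Proof. by move=> /cvgryPge. Qed.

Lemma cvgy_inv0 u : (u n @[n --> \oo] --> +oo)%classic ->
  ((u n)^-1 @[n --> \oo] --> (0 : R))%classic.
Proof.
move=> uy; apply/gtr0_cvgV0 => //; near=> n.
by apply: (@lt_le_trans _ _ 1) => //; near: n; exact: near_ge.
Unshelve. all: by end_near. Qed.

Lemma cvgy_sqrt_inv0 u : (u n @[n --> \oo] --> +oo)%classic ->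
  ((Num.sqrt (u n))^-1 @[n --> \oo] --> (0 : R))%classic.
Proof.
move=> uy; apply: cvgy_inv0; apply/cvgryPge => A; near=> n.
apply: (@le_trans _ _ `|A|); first exact: ler_norm.
by rewrite -sqrtr_sqr ler_wsqrtr //; near: n; exact: near_ge.
Unshelve. all: by end_near. Qed.

Lemma cvgy_ln_div0 u : (u n @[n --> \oo] --> +oo)%classic ->
  (ln (u n) / u n @[n --> \oo] --> (0 : R))%classic.
Proof.
move=> uy; apply: (@cvg_dist_le _ (fun n => 2 * (Num.sqrt (u n))^-1)).
  rewrite -[X in (_ --> X)%classic](mulr0 2).
  by apply: cvgM; [exact: cvg_cst|exact: cvgy_sqrt_inv0].
near=> n; have u1 : 1 <= u n by near: n; exact: near_ge.
have u0 : 0 < u n by apply: lt_le_trans u1.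
rewrite subr0 ger0_norm; last by rewrite divr_ge0 ?ln_ge0 // ltW.
rewrite ler_pdivrMr //; apply: (le_trans (ln_le_sqrt u0)).
by rewrite -[X in _ <= _ * X](sqr_sqrtr (ltW u0)) expr2 -mulrA mulKf // gt_eqF // sqrtr_gt0.
Unshelve. all: by end_near. Qed.
End Limits.

(** Rounding down a quotient by 4 loses at most 3/4. *)
Lemma natr_divn_ge (R : realType) (k : nat) :
  (3 * k%:R - 5) / 4 <= ((3 * k - 2) %/ 4)%N%:R :> R.
Proof.
have : (3 * k <= (3 * k - 2) %/ 4 * 4 + 5)%N by lia.
by rewrite -(ler_nat R) natrD !natrM ler_pdivrMr // lerBlDr.
Qed.

Section ThresholdAsymptotics.
Variables (R : realType) (p : R) (t : nat).
Hypothesis p01 : 0 < p < 1.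
Let lb : R := ln (1 - p)^-1.
Let lb0 : 0 < lb. Proof. exact: lnb_gt0. Qed.
Let l n : R := ln n%:R.
Let ly : (l n @[n --> \oo] --> +oo)%classic. Proof. exact: cvg_ln_natr. Qed.

(** The iterated logarithm and the constants are negligible against [2 ln n]. *)
Lemma alpha_tp_asymp : (alpha_tp t p n * lb / (2 * ln n%:R) @[n --> \oo] --> (1 : R))%classic.
Proof.
pose C1 := ((t%:R - 2) * (ln 2 - ln lb) +
  t%:R * (ln t%:R + ln (p / (1 - p)) - 1) - 2 * ln t`!%:R + 2 + lb) / 2 : R.
apply: (@cvg_near_eq _ _ (fun n => 1 + ((t%:R - 2) / 2 * (ln (l n) / l n) + C1 * (l n)^-1))).
  rewrite -[X in (_ --> X)%classic](_ : 1 + ((t%:R - 2) / 2 * 0 + C1 * 0) = 1); last by ring.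
  apply: cvgD; first exact: cvg_cst.
  apply: cvgD; (apply: cvgM; first exact: cvg_cst); first exact: cvgy_ln_div0.
  exact: cvgy_inv0.
near=> n.
have l1 : 1 <= l n by near: n; exact: near_ge.
have l0 : 0 < l n by apply: lt_le_trans l1.
have n2 : (2 <= n)%N by near: n; exact: nbhs_infty_ge.
have := alpha_tpE t p01 n2; rewrite -/lb -/(l n) lnM ?posrE ?divr_gt0 // ln_div ?posrE // => ->.
by rewrite /C1; field; rewrite gt_eqF.
Unshelve. all: by end_near. Qed.

Lemma alpha_tp_cvgy : (alpha_tp t p n @[n --> \oo] --> +oo)%classic.
Proof.
apply/cvgryPge => A; have /cvgrPdist_le ac := alpha_tp_asymp.
near=> n.
have l1 : 1 <= l n by near: n; exact: near_ge.
have lA : A * lb <= l n by near: n; exact: near_ge.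
have l0 : 0 < 2 * l n by rewrite mulr_gt0 // (lt_le_trans ltr01 l1).
have : `|1 - alpha_tp t p n * lb / (2 * l n)| <= 1 / 2 by near: n; apply: ac; lra.
rewrite ler_norml => /andP[_ h].
have {h} : 1 / 2 <= alpha_tp t p n * lb / (2 * l n) by lra.
rewrite ler_pdivlMr // => h; rewrite -(ler_pM2r lb0); lra.
Unshelve. all: by end_near. Qed.
End ThresholdAsymptotics.

(** * Moments and overlap ratios at the critical size *)

Section CriticalSize.
Variables (R : realType) (p : R) (t : nat).
Hypothesis p01 : 0 < p < 1.
Let lb : R := ln (1 - p)^-1.
Variables (k : nat -> nat) (D1 : R).
Hypothesis k_alpha : (\forall n \near \oo, `|(k n)%:R - alpha_tp t p n| <= D1)%classic.

Let lb0 : 0 < lb. Proof. exact: lnb_gt0. Qed.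
Let l n : R := ln n%:R.
Let rho n : R := (k n)%:R * lb / (2 * l n).

Let ly : (l n @[n --> \oo] --> +oo)%classic. Proof. exact: cvg_ln_natr. Qed.

Let rho_cvg : (rho n @[n --> \oo] --> (1 : R))%classic.
Proof.
apply: (@cvg_near_eq _ _ (fun n => alpha_tp t p n * lb / (2 * l n)
   + ((k n)%:R - alpha_tp t p n) * (l n)^-1 * (lb / 2))); last first.
  near=> n; have l1 : 1 <= l n by near: n; exact: near_ge.
  by rewrite /rho; field; rewrite gt_eqF // (lt_le_trans ltr01 l1).
rewrite -[X in (_ --> X)%classic](_ : 1 + 0 * (lb / 2) = 1); last by ring.
apply: cvgD; first exact: alpha_tp_asymp.
apply: cvgM; last exact: cvg_cst.
apply: (@cvg_dist_le _ _ (fun n => D1 * (l n)^-1)).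
  by rewrite -[X in (_ --> X)%classic](mulr0 D1); apply: cvgM; [exact: cvg_cst|exact: cvgy_inv0].
near=> n; have l1 : 1 <= l n by near: n; exact: near_ge.
have l0 : 0 < l n by apply: lt_le_trans l1.
have li0 : 0 <= (l n)^-1 by rewrite invr_ge0 ltW.
rewrite subr0 normrM (ger0_norm li0) ler_wpM2r //.
by near: n.
Unshelve. all: by end_near. Qed.

(** [rho] is the ratio of [k n] to [2 log_b n]. These bounds make negative the powers [rho / 2 - 1]
    and [1 - 3 * rho / 2] of [n] which govern the small and the large overlaps. *)
Let rho_bnd : (\forall n \near \oo, 5 / 6 <= rho n <= 3 / 2)%classic.
Proof.
have /cvgrPdist_le rc := rho_cvg.
near=> n; have : `|1 - rho n| <= 1 / 6 by near: n; apply: rc; lra.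
by rewrite ler_norml => /andP[h1 h2]; apply/andP; split; lra.
Unshelve. all: by end_near. Qed.

Let kE n : 1 <= l n -> (k n)%:R = 2 / lb * (rho n * l n).
Proof.
move=> l1; have l0 : 0 < l n by apply: lt_le_trans l1.
by rewrite /rho; field; rewrite !gt_eqF.
Qed.

Let ky : ((k n)%:R @[n --> \oo] --> (+oo : set_system R))%classic.
Proof.
apply/cvgryPge => A; near=> n.
have l1 : 1 <= l n by near: n; exact: near_ge.
have lA : A * lb <= l n by near: n; exact: near_ge.
have /andP[r1 _] : 5 / 6 <= rho n <= 3 / 2 by near: n.
rewrite kE // mulrAC ler_pdivlMr //; nra.
Unshelve. all: by end_near. Qed.

Let ln_rho_cvg : (ln (rho n) @[n --> \oo] --> (0 : R))%classic.
Proof.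
rewrite -(ln1 R); apply: (cvg_comp _ _ rho_cvg); exact: continuous_ln.
Qed.

Let ln_kE n : 1 <= l n -> 5 / 6 <= rho n -> ln (k n)%:R = ln (rho n) + ln (2 * (l n / lb)).
Proof.
move=> l1 r1; have l0 : 0 < l n by apply: lt_le_trans l1.
have r0 : 0 < rho n by lra.
have a0 : 0 < 2 * (l n / lb) by rewrite mulr_gt0 // divr_gt0.
by rewrite -lnM ?posrE // kE //; congr ln; ring.
Qed.

Let ln_k_cvg : (ln (k n)%:R / l n @[n --> \oo] --> (0 : R))%classic.
Proof.
apply: (@cvg_near_eq _ _ (fun n => ln (rho n) * (l n)^-1
    + (ln (l n) / l n + (ln 2 - ln lb) * (l n)^-1))).
  rewrite -[X in (_ --> X)%classic](_ : 0 * 0 + (0 + (ln 2 - ln lb) * 0) = 0); last by ring.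
  apply: cvgD; first by apply: cvgM; [exact: ln_rho_cvg|exact: cvgy_inv0].
  apply: cvgD; first exact: cvgy_ln_div0.
  by apply: cvgM; [exact: cvg_cst|exact: cvgy_inv0].
near=> n; have l1 : 1 <= l n by near: n; exact: near_ge.
have l0 : 0 < l n by apply: lt_le_trans l1.
have /andP[r1 _] : 5 / 6 <= rho n <= 3 / 2 by near: n.
by rewrite ln_kE // lnM ?posrE ?divr_gt0 // ln_div ?posrE //; ring.
Unshelve. all: by end_near. Qed.

Let k_div_n_cvg : ((k n)%:R / n%:R @[n --> \oo] --> (0 : R))%classic.
Proof.
apply: (@cvg_near_eq _ _ (fun n => 2 / lb * rho n * (l n / n%:R))).
  rewrite -[X in (_ --> X)%classic](mulr0 (2 / lb * 1)).
  apply: cvgM; first by apply: cvgM; [exact: cvg_cst|exact: rho_cvg].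
  apply: cvgy_ln_div0; exact: cvgr_idn.
near=> n; have l1 : 1 <= l n by near: n; exact: near_ge.
by rewrite kE //; ring.
Unshelve. all: by end_near. Qed.

(** After division by [k / 2], the errors of [ln_mean_asymp] and the term in [ln rho] all tend to 0:
    they are of order [ln rho], [1 / sqrt k] and [k / n]. *)
Lemma near_ln_mean (eta : R) : 0 < eta -> (\forall n \near \oo,
  `|ln (mean_stab p t 'I_n (k n)) - (k n)%:R / 2 * ((alpha_tp t p n - (k n)%:R) * lb)|
    <= (k n)%:R / 2 * eta)%classic.
Proof.
move=> eta0; have [D [D0 HD]] := ln_mean_asymp t p01.
have e_cvg : (`|t%:R - 2| * `|ln (rho n)| + 2 * D * (Num.sqrt (k n)%:R)^-1
   + 4 * ((k n)%:R / n%:R) @[n --> \oo] --> (0 : R))%classic.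
  have -> : 0 = `|t%:R - 2| * `|0 : R| + 2 * D * 0 + 4 * 0 :> R by rewrite normr0; ring.
  apply: cvgD; first apply: cvgD.
  - by apply: cvgM; [exact: cvg_cst|apply: cvg_norm; exact: ln_rho_cvg].
  - by apply: cvgM; [exact: cvg_cst|exact: cvgy_sqrt_inv0].
  - by apply: cvgM; [exact: cvg_cst|exact: k_div_n_cvg].
have /cvgr0Pnorm_le kc := k_div_n_cvg; have /cvgr0Pnorm_le ec := e_cvg.
near=> n.
have l1 : 1 <= l n by near: n; exact: near_ge.
have /andP[r1 _] : 5 / 6 <= rho n <= 3 / 2 by near: n.
have k1 : 1 <= (k n)%:R :> R by near: n; exact: near_ge.
have k0 : 0 < (k n)%:R :> R by apply: lt_le_trans k1.
have tk : (t + 3 <= k n)%N by rewrite -(ler_nat R); near: n; exact: near_ge.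
have n1 : 1 <= n%:R :> R by near: n; exact: nbhs_infty_ger.
have n0 : 0 < n%:R :> R by apply: lt_le_trans n1.
have kn : (2 * k n <= n)%N.
  rewrite -(ler_nat R) natrM.
  have : (k n)%:R / n%:R <= 1 / 2 :> R.
    by apply: (le_trans (ler_norm _)); near: n; apply: kc; lra.
  by rewrite ler_pdivrMr //; lra.
have e_le : `|t%:R - 2| * `|ln (rho n)| + 2 * D * (Num.sqrt (k n)%:R)^-1
   + 4 * ((k n)%:R / n%:R) <= eta.
  by apply: (le_trans (ler_norm _)); near: n; exact: ec.
have := HD n (k n) tk kn; rewrite /ln_mean_main -/lb -/(l n).
have -> : ln (k n)%:R - ln (2 * (l n / lb)) = ln (rho n) by rewrite ln_kE // addrK.
move=> h; set X := ln (mean_stab _ _ _ _) in h *; set Y := (alpha_tp t p n - _) * lb in h *.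
have -> : X - (k n)%:R / 2 * Y = (X - (k n)%:R / 2 * (Y + (t%:R - 2) * ln (rho n)))
   + (k n)%:R / 2 * ((t%:R - 2) * ln (rho n)) by ring.
apply: (le_trans (ler_normD _ _)).
apply: (@le_trans _ _ ((k n)%:R / 2 * (`|t%:R - 2| * `|ln (rho n)| +
   2 * D * (Num.sqrt (k n)%:R)^-1 + 4 * ((k n)%:R / n%:R)))); last first.
  by rewrite ler_wpM2l // divr_ge0 // ltW.
apply: (le_trans (lerD h (lexx _))).
rewrite !normrM [`|(k n)%:R|]ger0_norm // [`|2^-1|]ger0_norm //.
rewrite le_eqVlt; apply/orP; left; apply/eqP.
have -> : D * Num.sqrt (k n)%:R = (k n)%:R / 2 * (2 * D * (Num.sqrt (k n)%:R)^-1).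
  rewrite -{2}(sqr_sqrtr (ltW k0)); field; rewrite gt_eqF // sqrtr_gt0 //.
have sk0 : 0 < Num.sqrt (k n)%:R :> R by rewrite sqrtr_gt0.
by field; rewrite !gt_eqF.
Unshelve. all: by end_near. Qed.

Lemma mean_cvg0 (eps : R) : 0 < eps ->
  (\forall n \near \oo, alpha_tp t p n + eps <= (k n)%:R)%classic ->
  forall delta : R, 0 < delta ->
  (\forall n \near \oo, mean_stab p t 'I_n (k n) <= delta)%classic.
Proof.
(* The distance [eps] to the threshold gains [k / 2 * (2 * eta)] in the logarithm, and the error
   takes back at most half of it. *)
move=> e0 ke delta d0; pose eta := eps * lb / 2.
have eta0 : 0 < eta by rewrite divr_gt0 // mulr_gt0.
have H := near_ln_mean eta0.
near=> n.
have kd : - ln delta * 2 / eta <= (k n)%:R by near: n; exact: near_ge.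
have k0 : 0 <= (k n)%:R :> R by [].
have ken : alpha_tp t p n + eps <= (k n)%:R by near: n.
have : `|ln (mean_stab p t 'I_n (k n)) - (k n)%:R / 2 * ((alpha_tp t p n - (k n)%:R) * lb)|
    <= (k n)%:R / 2 * eta by near: n; exact: H.
rewrite ler_norml => /andP[_ h].
have h2 : (k n)%:R / 2 * ((alpha_tp t p n - (k n)%:R) * lb) <= (k n)%:R / 2 * (- (2 * eta)).
  rewrite ler_wpM2l // ?divr_ge0 //.
  have -> : - (2 * eta) = - eps * lb by rewrite /eta; field.
  by rewrite ler_wpM2r ?(ltW lb0) //; lra.
have h3 : - ln delta <= (k n)%:R / 2 * eta.
  by move: kd; rewrite ler_pdivrMr //; lra.
(* Comparison through [ln] needs a positive mean; the mean is zero when [k n > n]. *)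
case: (lerP (mean_stab p t 'I_n (k n)) 0) => [m0|m0]; first exact: le_trans (ltW d0).
by rewrite -ler_ln ?posrE //; lra.
Unshelve. all: by end_near. Qed.

Lemma mean_cvgy (eps : R) : 0 < eps ->
  (\forall n \near \oo, (k n)%:R <= alpha_tp t p n - eps)%classic ->
  forall A : R, 0 < A ->
  (\forall n \near \oo, A <= mean_stab p t 'I_n (k n))%classic.
Proof.
move=> e0 ke A A0; pose eta := eps * lb / 2.
have eta0 : 0 < eta by rewrite divr_gt0 // mulr_gt0.
have H := near_ln_mean eta0.
have /cvgr0Pnorm_le kc := k_div_n_cvg.
near=> n.
have kd : ln A * 2 / eta <= (k n)%:R by near: n; exact: near_ge.
have k0 : 0 <= (k n)%:R :> R by [].
have ken : (k n)%:R <= alpha_tp t p n - eps by near: n.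
have : `|ln (mean_stab p t 'I_n (k n)) - (k n)%:R / 2 * ((alpha_tp t p n - (k n)%:R) * lb)|
    <= (k n)%:R / 2 * eta by near: n; exact: H.
rewrite ler_norml => /andP[h _].
have h2 : (k n)%:R / 2 * (2 * eta) <= (k n)%:R / 2 * ((alpha_tp t p n - (k n)%:R) * lb).
  rewrite ler_wpM2l // ?divr_ge0 //.
  have -> : 2 * eta = eps * lb by rewrite /eta; field.
  by rewrite ler_wpM2r ?(ltW lb0) //; lra.
have h3 : ln A <= (k n)%:R / 2 * eta.
  by move: kd; rewrite ler_pdivrMr //; lra.
have n1 : 1 <= n%:R :> R by near: n; exact: nbhs_infty_ger.
have n0 : 0 < n%:R :> R by apply: lt_le_trans n1.
have kn : (k n <= n)%N.
  rewrite -(ler_nat R).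
  have : (k n)%:R / n%:R <= 1 :> R.
    by apply: (le_trans (ler_norm _)); near: n; apply: kc; lra.
  by rewrite ler_pdivrMr // mul1r.
have m0 : 0 < mean_stab p t 'I_n (k n).
  by rewrite mulr_gt0 ?stab_probn_gt0 // ltr0n bin_gt0 card_ord.
by rewrite -ler_ln ?posrE //; lra.
Unshelve. all: by end_near. Qed.

Lemma near_small_overlap (delta : R) : 0 < delta ->
  (\forall n \near \oo, (k n)%:R ^+ 2 / n%:R * (1 - p) ^- (k n %/ 4).+1 <= delta)%classic.
Proof.
move=> d0; have q1 : 0 < 1 - p by rewrite subr_gt0; case/andP: p01.
have /cvgr0Pnorm_le lkc := ln_k_cvg.
near=> n.
have l1 : 1 <= l n by near: n; exact: near_ge.
have l0 : 0 < l n by apply: lt_le_trans l1.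
have n1 : 1 <= n%:R :> R by near: n; exact: nbhs_infty_ger.
have n0 : 0 < n%:R :> R by apply: lt_le_trans n1.
have k1 : 1 <= (k n)%:R :> R by near: n; exact: near_ge.
have k0 : 0 < (k n)%:R :> R by apply: lt_le_trans k1.
have /andP[_ r2] : 5 / 6 <= rho n <= 3 / 2 by near: n.
have lk : ln (k n)%:R <= 1 / 32 * l n.
  rewrite -ler_pdivrMr //; apply: (le_trans (ler_norm _)); near: n; apply: lkc; lra.
have lB : 16 * lb <= l n by near: n; exact: near_ge.
(* The coefficients of [l n] will add up to [1/16 - 1 + 3/4 + 1/16 = - 1/8]. *)
have lD : - 8 * ln delta <= l n by near: n; exact: near_ge.
rewrite -ler_ln ?posrE ?mulr_gt0 ?invr_gt0 ?exprn_gt0 //.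
rewrite lnM ?posrE ?divr_gt0 ?invr_gt0 ?exprn_gt0 // ln_div ?posrE ?exprn_gt0 // lnXn //.
rewrite lnV ?posrE ?exprn_gt0 // lnXn //.
have -> : ln (1 - p) = - lb by rewrite /lb lnV ?posrE // opprK.
rewrite -/(l n) -[ln (k n)%:R *+ 2]mulr_natl -[- lb *+ _]mulr_natl.
have h4 : (k n %/ 4).+1%:R <= (k n)%:R / 4 + 1 :> R.
  by rewrite -natr1 lerD2r ler_pdivlMr // -natrM ler_nat leq_divM.
have h5 : (k n %/ 4).+1%:R * lb <= ((k n)%:R / 4 + 1) * lb by rewrite ler_wpM2r // ltW.
have h6 : (k n)%:R / 4 * lb = rho n * l n / 2 by rewrite kE //; field; rewrite gt_eqF.
have h7 : rho n * l n <= 3 / 2 * l n by rewrite ler_wpM2r // ltW.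
by lra.
Unshelve. all: by end_near. Qed.

Lemma near_large_overlap (delta : R) : 0 < delta ->
  (\forall n \near \oo,
    (k n)%:R ^+ (2 * t).+1 * n%:R * (1 - p) ^+ ((3 * k n - 2) %/ 4) <= delta)%classic.
Proof.
move=> d0; have q1 : 0 < 1 - p by rewrite subr_gt0; case/andP: p01.
have /cvgr0Pnorm_le lkc := ln_k_cvg.
near=> n.
have l1 : 1 <= l n by near: n; exact: near_ge.
have l0 : 0 < l n by apply: lt_le_trans l1.
have n1 : 1 <= n%:R :> R by near: n; exact: nbhs_infty_ger.
have n0 : 0 < n%:R :> R by apply: lt_le_trans n1.
have k1 : 1 <= (k n)%:R :> R by near: n; exact: near_ge.
have k0 : 0 < (k n)%:R :> R by apply: lt_le_trans k1.
have /andP[r1 _] : 5 / 6 <= rho n <= 3 / 2 by near: n.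
pose T1 : R := (2 * t).+1%:R.
have T0 : 0 < T1 by rewrite ltr0n.
have lk : T1 * ln (k n)%:R <= 1 / 32 * l n.
  rewrite mulrC -ler_pdivlMr // mulrAC -ler_pdivrMr //.
  apply: (le_trans (ler_norm _)); near: n; apply: lkc.
  by rewrite divr_gt0 // ltr0n.
have lB : 32 * lb <= l n by near: n; exact: near_ge.
(* Here the coefficients of [l n] add up to [1/32 + 1 - 5/4 + 5/128], which is below [- 1/8]. *)
have lD : - 8 * ln delta <= l n by near: n; exact: near_ge.
rewrite -ler_ln ?posrE ?mulr_gt0 ?exprn_gt0 //.
rewrite lnM ?posrE ?mulr_gt0 ?exprn_gt0 // lnM ?posrE ?exprn_gt0 // !lnXn //.
rewrite -[ln _ *+ (2 * t).+1]mulr_natl -/T1 -/(l n).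
have -> : ln (1 - p) = - lb by rewrite /lb lnV ?posrE // opprK.
rewrite -[- lb *+ _]mulr_natl.
have h4 : (3 * (k n)%:R - 5) / 4 <= ((3 * k n - 2) %/ 4)%N%:R :> R by exact: natr_divn_ge.
have h5 : (3 * (k n)%:R - 5) / 4 * lb <= ((3 * k n - 2) %/ 4)%N%:R * lb by rewrite ler_wpM2r // ltW.
have h6 : (3 * (k n)%:R - 5) / 4 * lb = 3 / 2 * (rho n * l n) - 5 / 4 * lb.
  by rewrite kE //; field; rewrite gt_eqF.
have h7 : 5 / 6 * l n <= rho n * l n by rewrite ler_wpM2r // ltW.
by lra.
Unshelve. all: by end_near. Qed.

Lemma nostab_cvg0 (eps : R) : 0 < eps ->
  (\forall n \near \oo, (k n)%:R <= alpha_tp t p n - eps)%classic ->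
  forall delta : R, 0 < delta ->
  (\forall n \near \oo,
     Ex p (pairs [set: 'I_n]) (fun E => (nostab t (k n) E)%:R) <= delta)%classic.
Proof.
move=> e0 ke delta d0; case/andP: (p01) => p0 p1; have q1 : 0 < 1 - p by rewrite subr_gt0.
pose K := expR (p / (1 - p)); have K0 : 0 < K by exact: expR_gt0.
(* In the bound [2 * x + 2 * K / mu], each term is at most [delta / 2] once [x <= delta / 4] and
   [mu >= 4 * K / delta]. *)
have d4 : 0 < delta / 4 by rewrite divr_gt0.
have dK : 0 < 4 * K / delta by rewrite divr_gt0 // mulr_gt0.
have h2 : (0 : R) < 2^-1 by [].
have X1 := near_small_overlap h2; have X2 := near_small_overlap d4.
have Z1 := near_large_overlap h2; have Mu := mean_cvgy e0 ke dK.
have /cvgr0Pnorm_le kc := k_div_n_cvg.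
near=> n.
have n1 : 1 <= n%:R :> R by near: n; exact: nbhs_infty_ger.
have n0 : 0 < n%:R :> R by apply: lt_le_trans n1.
have k1 : 1 <= (k n)%:R :> R by near: n; exact: near_ge.
have k0 : (0 < k n)%N by rewrite -(ltr0n R); apply: lt_le_trans k1.
have kn : (k n <= #|'I_n|)%N.
  rewrite card_ord -(ler_nat R).
  have : (k n)%:R / n%:R <= 1 :> R.
    by apply: (le_trans (ler_norm _)); near: n; apply: kc; lra.
  by rewrite ler_pdivrMr // mul1r.
have KK : (1 + p / (1 - p) / (k n)%:R ^+ 2) ^+ (k n ^ 2) <= K.
  have k2 : 0 < (k n)%:R ^+ 2 :> R by rewrite exprn_gt0 // ltr0n.
  apply: (@le_trans _ _ (expR (p / (1 - p) / (k n)%:R ^+ 2) ^+ (k n ^ 2))).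
    by apply: lerXn2r; rewrite ?nnegrE ?expR_ge0 ?expR_ge1Dx // addr_ge0 // !divr_ge0 // ltW.
  by rewrite -expRM_natr natrX divfK // gt_eqF.
have x1 : (k n)%:R ^+ 2 / n%:R * (1 - p) ^- (k n %/ 4).+1 <= 2^-1 by near: n.
have x2 : (k n)%:R ^+ 2 / n%:R * (1 - p) ^- (k n %/ 4).+1 <= delta / 4 by near: n.
have z1 : (k n)%:R ^+ (2 * t).+1 * n%:R * (1 - p) ^+ ((3 * k n - 2) %/ 4) <= 2^-1 by near: n.
have mu1 : 4 * K / delta <= mean_stab p t 'I_n (k n) by near: n.
have := @nostab_prob_le R p t p01 'I_n (k n) K k0 kn KK.
rewrite !card_ord => /(_ x1 z1) h; apply: (le_trans h).
have mu0 : 0 < mean_stab p t 'I_n (k n) by apply: lt_le_trans mu1.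
have : 2 * K / mean_stab p t 'I_n (k n) <= delta / 2.
  rewrite ler_pdivrMr //; move: mu1; rewrite ler_pdivrMr //; lra.
lra.
Unshelve. all: by end_near. Qed.
End CriticalSize.

(** * Transfer to the random graph, and union bound *)

Section RandomGraph.
Variables (R : realType) (p : R).

Lemma pairs_vpairs (T : finType) : pairs [set: T] = vpairs T.
Proof. by apply/setP => e; rewrite !inE finset.subsetT. Qed.

Lemma Ex_Gnp n (F : {set {set 'I_n}} -> R) :
  Ex p (pairs [set: 'I_n]) F = \sum_(G : sgraph 'I_n) Gnp_mass p G * F (edges G).
Proof.
rewrite /Ex pairs_vpairs; pose G0 : sgraph 'I_n := SGraph (sub0set (vpairs 'I_n)).
rewrite (reindex_onto (fun G : sgraph 'I_n => val G) (fun E => insubd G0 E)) /=; last first.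
  by move=> E EP; rewrite -[edges _]/(val _) insubdK.
by apply: eq_bigl => G; rewrite -[edges G]/(val G) valKd eqxx andbT; exact: edgesP.
Qed.

Lemma stableE t (T : finType) (G : sgraph T) (S : {set T}) :
  stable t G S = tstab t (edges G) S.
Proof. by apply/bigmax_leqP/forall_inP. Qed.

Lemma stability_lt_nostab t k (T : finType) (G : sgraph T) :
  (stability_number t G < k)%N -> nostab t k (edges G).
Proof.
move=> sk; apply/forallP => S; apply/implyP => /eqP Sk; apply/negP => st.
move: sk; rewrite ltnNge => /negP; apply.
by rewrite -Sk; apply: (bigop.bigmax_sup S) => //; rewrite stableE.
Qed.

(** Subsets of stable sets are stable, so a largest stable set contains one of size exactly [k]. *)
Lemma stability_ge_nostab t k (T : finType) (G : sgraph T) :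
  (k <= stability_number t G)%N -> ~~ nostab t k (edges G).
Proof.
have s0 : stable t G finset.set0 by rewrite stableE; apply/forall_inP => v; rewrite inE.
rewrite /stability_number (bigop.bigmax_eq_arg _ s0); case: arg_maxnP => // S st _.
move=> /card_geqP[s [us sk sS]].
apply/forallPn; exists [set x in s]; rewrite negb_imply negbK cardsE.
rewrite (card_uniqP us) sk eqxx /=; move: st; rewrite stableE; apply: tstab_sub => //.
by apply/fintype.subsetP => x; rewrite inE; exact: sS.
Qed.
End RandomGraph.

Theorem theorem1 (R : realType) (p : R) (p_gt0 : 0 < p) (p_lt1 : p < 1) (t : nat)
    (eps : R) (eps_gt0 : 0 < eps) :
  Gnp_aas p (fun (n : nat) (G : sgraph 'I_n) =>
    (Num.floor (alpha_tp t p n - eps) <= (stability_number t G)%:Z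
       <= Num.floor (alpha_tp t p n + eps))).
Proof.
have p01 : 0 < p < 1 by rewrite p_gt0.
(* The bounds fail exactly if the stability number is below [kL] or at least [kU], once the floors
   are nonnegative; hence the shift by 1 in [kU]. *)
pose kL n := absz (Num.floor (alpha_tp t p n - eps)).
pose kU n := absz (Num.floor (alpha_tp t p n + eps) + 1).
have kLE : (\forall n \near \oo, (kL n)%:Z = Num.floor (alpha_tp t p n - eps))%classic.
  near=> n; rewrite gez0_abs // floor_ge0 subr_ge0; near: n.
  by apply: near_ge; exact: alpha_tp_cvgy.
have kUE : (\forall n \near \oo, (kU n)%:Z = Num.floor (alpha_tp t p n + eps) + 1)%classic.
  near=> n; rewrite gez0_abs // addr_ge0 // floor_ge0 addr_ge0 ?(ltW eps_gt0) //; near: n.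
  by apply: near_ge; exact: alpha_tp_cvgy.
have kL_le : (\forall n \near \oo, (kL n)%:R <= alpha_tp t p n - eps)%classic.
  near=> n; rewrite pmulrn; have -> : (kL n)%:Z = Num.floor (alpha_tp t p n - eps) by near: n.
  by have /andP[] := floor_itv (alpha_tp t p n - eps).
have kL_ge : (\forall n \near \oo, `|(kL n)%:R - alpha_tp t p n| <= eps + 1)%classic.
  near=> n; have : (kL n)%:R <= alpha_tp t p n - eps by near: n.
  rewrite !pmulrn; have -> : (kL n)%:Z = Num.floor (alpha_tp t p n - eps) by near: n.
  have := floorD1_gt (alpha_tp t p n - eps); rewrite intrD => h1 h2.
  by rewrite ler_norml; apply/andP; split; lra.
have kU_ge : (\forall n \near \oo, alpha_tp t p n + eps <= (kU n)%:R)%classic.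
  near=> n; rewrite pmulrn; have -> : (kU n)%:Z = Num.floor (alpha_tp t p n + eps) + 1 by near: n.
  exact/ltW/floorD1_gt.
have kU_le : (\forall n \near \oo, `|(kU n)%:R - alpha_tp t p n| <= eps + 1)%classic.
  near=> n; have : alpha_tp t p n + eps <= (kU n)%:R by near: n.
  rewrite !pmulrn; have -> : (kU n)%:Z = Num.floor (alpha_tp t p n + eps) + 1 by near: n.
  have /andP[+ _] := floor_itv (alpha_tp t p n + eps); rewrite intrD => h1 h2.
  by rewrite ler_norml; apply/andP; split; lra.
apply/cvgrPdist_le => delta d0; have d2 : 0 < delta / 2 by rewrite divr_gt0.
have HU := mean_cvg0 p01 kU_le eps_gt0 kU_ge d2.
have HL := nostab_cvg0 p01 kL_ge eps_gt0 kL_le d2.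
near=> n.
have hU : mean_stab p t 'I_n (kU n) <= delta / 2 by near: n; exact: HU.
have hL : Ex p (pairs [set: 'I_n]) (fun E => (nostab t (kL n) E)%:R) <= delta / 2.
  by near: n; exact: HL.
have eL : (kL n)%:Z = Num.floor (alpha_tp t p n - eps) by near: n.
have eU : (kU n)%:Z = Num.floor (alpha_tp t p n + eps) + 1 by near: n.
have {}hU := le_trans (first_moment t p01 'I_n (kU n)) hU.
rewrite -eL.
have -> : Num.floor (alpha_tp t p n + eps) = (kU n)%:Z - 1 by rewrite eU addrK.
move: hL hU; rewrite !Ex_Gnp => hL hU.
have mass1 : \sum_(G : sgraph 'I_n) Gnp_mass p G = 1.
  rewrite -[RHS](Ex_cst p (pairs [set: 'I_n])) Ex_Gnp.
  by apply: eq_bigr => G _; rewrite mulr1.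
have mass0 (G : sgraph 'I_n) : 0 <= Gnp_mass p G.
  by apply: prodr_ge0 => e _; case: ifP => _; rewrite ?subr_ge0 ltW.
rewrite /Gnp_prob big_mkcond; set X := \sum_(G : _) _ in hL; set Y := \sum_(G : _) _ in hU.
set A := fun G : sgraph 'I_n => ((kL n)%:Z <= (stability_number t G)%:Z <= (kU n)%:Z - 1)%R.
have Ale : \sum_(G : sgraph 'I_n) (if A G then Gnp_mass p G else 0) <= 1.
  by rewrite -mass1; apply: ler_sum => G _; case: (A G).
(* Union bound: a graph violating the lower bound is counted in [X], and one violating the upper
   bound in [Y]. *)
have : 1 <= \sum_(G : sgraph 'I_n) (if A G then Gnp_mass p G else 0) + (X + Y).
  rewrite -mass1 -!big_split /=; apply: ler_sum => G _.
  have m0 := mass0 G.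
  case: (boolP (A G)) => [_|]; first by rewrite lerDl addr_ge0 // mulr_ge0.
  rewrite negb_and -!ltNge => /orP[hlt|hgt].
    rewrite stability_lt_nostab // mulr1 add0r lerDl mulr_ge0 //.
  rewrite (stability_ge_nostab (k := kU n)) ?mulr1 ?add0r ?lerDr ?mulr_ge0 //.
  by move: hgt; lia.
rewrite ler_norml => h; apply/andP; split; lra.
Unshelve. all: by end_near. Qed.
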